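(* Let $M$ be a simply connected oriented Riemannian surface and suppose that $E=\mathbb Re_0\oplus\mathbb Re_1$, where $e_0,e_1$ are unit, orthogonal and parallel sections of $E$ with $\langle e_0,e_0\rangle=-1$, $\langle e_1,e_1\rangle=1$, $e_0$ future-directed and $(e_0,e_1)$ positively oriented. Let $\vec H$ be a section of $E$ and $\varphi\in\Gamma(\Sigma)$ a solution of $D\varphi=\vec H\cdot\varphi$ with $H(\varphi,\varphi)=1$, and let $F_\varphi:M\to\mathbb R^{1,3}$ be the isometric immersion defined by $\varphi$ (unique up to translations). Containment in $\mathbb R^3,\mathbb R^{1,2},\mathbb H^3$ below is understood up to translations. 1. Assume that $\vec H=He_1$ (with $H$ a real function) and $e_1\cdot\varphi=e_2\cdot e_3\cdot\varphi$, where $(e_2,e_3)$ is a positively oriented orthonormal frame of $M$. Then the immersion belongs to $\mathbb R^3$. 2. Assume that $\vec H=He_0$ (with $H$ a real function) and $e_1\cdot\varphi=\pm i\varphi$. Then the immersion belongs to $\mathbb R^{1,2}$. 3. Consider the function $F:=\langle\langle e_0\cdot\varphi,\varphi\rangle\rangle$ and assume that $\vec H=e_0+He_1$ (with $H$ a real function) and $dF(X)=\langle\langle X\cdot\varphi,\varphi\rangle\rangle$ for all $X\in\Gamma(TM)$. Then the immersion belongs to $\mathbb H^3$. Reciprocally, if the immersion belongs to $\mathbb R^3$ (resp. to $\mathbb R^{1,2}$, $\mathbb H^3$), then the condition assumed in 1 (resp. in 2, in 3) holds for some unit, orthogonal and parallel sections $(e_0,e_1)$ of $E$.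
   Context: Complex quaternions: $\mathbb{H}^{\mathbb{C}}=\{q_0\mathbf 1+q_1I+q_2J+q_3K:\ q_j\in\mathbb{C}\}$ is the $\mathbb C$-algebra with unit $\mathbf 1$ and $I^2=J^2=K^2=-\mathbf 1$, $IJ=-JI=K$. For $q=q_0\mathbf 1+q_1I+q_2J+q_3K$ put $\overline q=q_0\mathbf 1-q_1I-q_2J-q_3K$ and $\hat q=\overline{q_0}\mathbf 1+\overline{q_1}I+\overline{q_2}J+\overline{q_3}K$ (complex conjugation of the coefficients), and let $H(q,q')=q_0q_0'+q_1q_1'+q_2q_2'+q_3q_3'\in\mathbb C$. Minkowski space $\mathbb{R}^{1,3}$ (metric $-dx_0^2+dx_1^2+dx_2^2+dx_3^2$) is identified with $\{\xi\in\mathbb H^{\mathbb C}:\xi=-\hat{\overline\xi}\}$ via $(x_0,x_1,x_2,x_3)\mapsto ix_0\mathbf 1+x_1I+x_2J+x_3K$, the metric being the restriction of $H$. $Spin(1,3)=\{q\in\mathbb H^{\mathbb C}: H(q,q)=1\}$, acting on $\mathbb R^{1,3}$ by $\xi\mapsto q\xi\hat q^{-1}$. Inside $\mathbb R^{1,3}$: $\mathbb R^3=(i\mathbf 1)^\perp$, $\mathbb R^{1,2}=I^\perp$, $\mathbb H^3=\{X:\langle X,X\rangle=-1,\ X_0>0\}$. Twisted spinor bundle: $M$ is an oriented Riemannian surface and $E\to M$ a rank $2$ real vector bundle with a metric of signature $(1,1)$ on the fibers, a compatible connection and an orientation in space and in time; spin structures $\tilde Q_1\to Q_1$, $\tilde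 Q_2\to Q_2$ are given on $E$ and $TM$, where $Q_1,Q_2$ are the bundles of positively oriented orthonormal frames of $E$ (first vector timelike future-directed) and of $TM$. Let $Spin(1,1)=\{\pm(\cosh t\,\mathbf 1+i\sinh t\,I):t\in\mathbb R\}$, $Spin(2)=\{\cos\theta\,\mathbf 1+\sin\theta\, I:\theta\in\mathbb R\}$ (subgroups of $Spin(1,3)$) and $\tilde Q=\tilde Q_1\times_M\tilde Q_2$. Then $\Sigma=\Sigma E\otimes\Sigma M$ is the bundle associated with $\tilde Q$ and the representation of $Spin(1,1)\times Spin(2)$ on $\mathbb H^{\mathbb C}$ by left multiplication $(g_1,g_2)\mapsto(\xi\mapsto g_1g_2\xi)$, with the connection $\nabla$ induced by the connection of $E$ and the Levi-Civita connection of $M$. In a local section $\tilde s$ of $\tilde Q$ lying over a frame $(e_0,e_1,e_2,e_3)$, a spinor $\varphi$ has a coordinate $[\varphi]\in\mathbb H^{\mathbb C}$, a vector $X=\sum_j x_je_j\in E\oplus TM$ has coordinate $[X]=ix_0\mathbf 1+x_1I+x_2J+x_3K$, and the Clifford product is $[X\cdot\varphi]=[X]\widehat{[\varphi]}$. On $\Sigma$ one sets $H(\psi,\psi')=H([\psi],[\psi'])$, $\langle\langle\psi,\psi'\rangle\rangle=\overline{[\psi']}[\psi]$ (independent of $\tilde s$). $D\varphi=e_2\cdot\nabla_{e_2}\varphi+e_3\cdot\nabla_{e_3}\varphi$. In item 2, $i\varphi$ refers to the standard complex structure of $\Sigma$, which is right multiplication by $I$: $[i\varphi]=[\varphi]I$.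 The immersion defined by $\varphi$: $F_\varphi$ satisfies $dF_\varphi(X)=\langle\langle X\cdot\varphi,\varphi\rangle\rangle$ for $X\in TM$; it is an isometric immersion with normal bundle identified with $E$ by $Y\mapsto\langle\langle Y\cdot\varphi,\varphi\rangle\rangle$ and with mean curvature vector $\vec H$. *)

(* Defs.v *)
From HB Require Import structures.
From mathcomp Require Export all_boot all_order all_algebra.
From mathcomp Require Export all_classical all_reals all_analysis.
From mathcomp Require Export complex.
From mathcomp Require Import ring.

Set Implicit Arguments.
Unset Strict Implicit.
Unset Printing Implicit Defensive.

Import Order.TTheory GRing.Theory Num.Theory.
Import numFieldNormedType.Exports.

Local Open Scope classical_set_scope.
Local Open Scope complex_scope.
Local Open Scope ring_scope.

(* q0 1 + q1 I + q2 J + q3 K is the row (q0, q1, q2, q3). *)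
Notation HC R := 'rV[R[i]]_4.

Definition quat {R : realType} (a b c d : R[i]) : HC R :=
  \row_k nth 0 [:: a; b; c; d] k.

Definition hone {R : realType} : HC R := quat 1 0 0 0.
Definition hI {R : realType} : HC R := quat 0 1 0 0.
Definition hJ {R : realType} : HC R := quat 0 0 1 0.
Definition hK {R : realType} : HC R := quat 0 0 0 1.

Definition hmul {R : realType} (p q : HC R) : HC R :=
  let p0 := p 0 0 in let p1 := p 0 1 in let p2 := p 0 2 in let p3 := p 0 3 in
  let q0 := q 0 0 in let q1 := q 0 1 in let q2 := q 0 2 in let q3 := q 0 3 in
  quat (p0 * q0 - p1 * q1 - p2 * q2 - p3 * q3)
       (p0 * q1 + p1 * q0 + p2 * q3 - p3 * q2)
       (p0 * q2 - p1 * q3 + p2 * q0 + p3 * q1)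
       (p0 * q3 + p1 * q2 - p2 * q1 + p3 * q0).

Definition hbar {R : realType} (q : HC R) : HC R :=
  quat (q 0 0) (- q 0 1) (- q 0 2) (- q 0 3).

Definition hhat {R : realType} (q : HC R) : HC R :=
  \row_k conjc (q 0 k).

Definition hform {R : realType} (q r : HC R) : R[i] :=
  \sum_(k < 4) q 0 k * r 0 k.

(* The inverse of q when hform q q != 0, since q * hbar q = hform q q. *)
Definition hinv {R : realType} (q : HC R) : HC R :=
  (hform q q)^-1 *: hbar q.

Definition mink {R : realType} (x0 x1 x2 x3 : R) : HC R :=
  quat (0 +i* x0) x1%:C x2%:C x3%:C.

Definition R13 {R : realType} : set (HC R) :=
  [set xi | xi = - hhat (hbar xi)].

Definition R3 {R : realType} : set (HC R) :=
  [set xi | R13 xi /\ hform xi (mink 1 0 0 0) = 0].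

Definition R12 {R : realType} : set (HC R) :=
  [set xi | R13 xi /\ hform xi hI = 0].

(* The time coordinate of xi in R13 is the imaginary part of its 1-component. *)
Definition H3 {R : realType} : set (HC R) :=
  [set xi | [/\ R13 xi, hform xi xi = -1 & 0 < complex.Im (xi 0 0)]].

Definition cosh {R : realType} (t : R) : R := (expR t + expR (- t)) / 2.
Definition sinh {R : realType} (t : R) : R := (expR t - expR (- t)) / 2.

Definition Spin11 {R : realType} : set (HC R) :=
  [set g | exists t : R,
     let h := quat (cosh t)%:C (0 +i* sinh t) 0 0 in g = h \/ g = - h].

Definition Spin2 {R : realType} : set (HC R) :=
  [set g | exists t : R, g = quat (cos t)%:C (sin t)%:C 0 0].

(* f is of class C^n on the open set U. *)
Fixpoint Ck {R : realType} {V W : normedModType R} (n : nat) (U : set V)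
    (f : V -> W) : Prop :=
  if n is n'.+1 then
    (forall x, U x -> differentiable f x) /\
    (forall v, Ck n' U (fun x => 'd f x v))
  else forall x, U x -> {for x, continuous f}.

Definition smooth {R : realType} {V W : normedModType R} (U : set V)
    (f : V -> W) : Prop := forall n, Ck n U f.

(* The oriented atlas is indexed by the points: chart p is a chart with domain
   dom p around p, and chart_inv p is its inverse. *)
Record surface (R : realType) := Surface {
  point :> topologicalType;
  dom : point -> set point;
  chart : point -> point -> 'rV[R]_2;
  chart_inv : point -> 'rV[R]_2 -> point;
  surface_hausdorff : hausdorff_space point;
  surface_second_countable : @second_countable point;
  dom_center : forall p, dom p p;
  dom_open : forall p, open (dom p);
  chart_open : forall p, open (chart p @` dom p);
  chartK : forall p q, dom p q -> chart_inv p (chart p q) = q;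
  chart_continuous : forall p q, dom p q -> {for q, continuous (chart p)};
  chart_inv_continuous : forall p x, (chart p @` dom p) x ->
    {for x, continuous (chart_inv p)};
  transition_smooth : forall p q,
    smooth (chart p @` (dom p `&` dom q)) (chart q \o chart_inv p);
  transition_oriented : forall p q r, (dom p `&` dom q) r ->
    0 < \det (jacobian (chart q \o chart_inv p) (chart p r))
}.

Definition path_connected {R : realType} (T : topologicalType) : Prop :=
  forall x y : T, exists c : R -> T,
    [/\ {within `[0, 1], continuous c}, c 0 = x & c 1 = y].

Definition null_homotopic {R : realType} (T : topologicalType) (c : R -> T) :=
  exists h : R * R -> T,
    [/\ {within `[0, 1] `*` `[0, 1], continuous h},
        forall t, t \in `[0, 1] -> h (0, t) = c t,
        forall t, t \in `[0, 1] -> h (1, t) = c 0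
      & forall s, s \in `[0, 1] -> h (s, 0) = c 0 /\ h (s, 1) = c 0].

Definition simply_connected {R : realType} (M : surface R) : Prop :=
  path_connected (R := R) M /\
  forall c : R -> M, {within `[0, 1], continuous c} -> c 0 = c 1 ->
    null_homotopic c.

(* A tangent vector at p is given by its components in the chart chart p. *)
Definition tangent {R : realType} {M : surface R} (p : M) : lmodType R :=
  'rV[R]_2.

Definition smooth_fun {R : realType} {M : surface R} (U : set M)
    (f : M -> R) : Prop :=
  forall p, smooth (chart p @` (dom p `&` U)) (f \o chart_inv p).

Definition dfun {R : realType} {M : surface R} (f : M -> R) (p : M)
    (v : tangent p) : R :=
  'd (f \o chart_inv p) (chart p p) v.

Definition smooth_hc {R : realType} {M : surface R} (U : set M)
    (f : M -> HC R) : Prop :=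
  forall k, smooth_fun U (fun p => complex.Re (f p 0 k)) /\
            smooth_fun U (fun p => complex.Im (f p 0 k)).

Definition dhc {R : realType} {M : surface R} (f : M -> HC R) (p : M)
    (v : tangent p) : HC R :=
  \row_k (dfun (fun q => complex.Re (f q 0 k)) v +i*
          dfun (fun q => complex.Im (f q 0 k)) v).

(* Local sections are represented by total ones; a vector bundle is a family of
   fibres V with a predicate sm U s, "s is a smooth section on the open U". *)
Definition section {R : realType} {M : surface R} (V : M -> lmodType R) :=
  forall p, V p.

Definition smooth_vf {R : realType} {M : surface R} (U : set M)
    (X : section (@tangent R M)) : Prop :=
  forall V f, open V -> V `<=` U -> smooth_fun V f ->
    smooth_fun V (fun p => dfun f (X p)).

Definition is_local {M : topologicalType} {S : Type} (sm : set M -> S -> Prop) :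
    Prop :=
  (forall U V s, open U -> open V -> V `<=` U -> sm U s -> sm V s) /\
  (forall U s, open U ->
     (forall p, U p -> exists V, [/\ open V, V p & sm V s]) -> sm U s).

Definition local_frame {R : realType} {M : surface R} (V : M -> lmodType R)
    (sm : set M -> section V -> Prop) (U : set M) (a b : section V) : Prop :=
  (forall p, U p -> forall v : V p,
     exists! x : R * R, v = x.1 *: a p + x.2 *: b p) /\
  (forall (W : set M) (s : section V) (x y : M -> R), open W -> W `<=` U ->
     (forall p, W p -> s p = x p *: a p + y p *: b p) ->
     (sm W s <-> smooth_fun W x /\ smooth_fun W y)).

Definition is_bundle2 {R : realType} {M : surface R} (V : M -> lmodType R)
    (sm : set M -> section V -> Prop) : Prop :=
  is_local sm /\
  forall p : M, exists U a b, [/\ open U, U p & local_frame sm U a b].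

Definition is_metric {R : realType} {M : surface R} (V : M -> lmodType R)
    (sm : set M -> section V -> Prop) (g : forall p, V p -> V p -> R) : Prop :=
  [/\ forall p (u v : V p), g p u v = g p v u,
      forall p a (u v w : V p), g p (a *: u + v) w = a * g p u w + g p v w
    & forall U s t, open U -> sm U s -> sm U t ->
        smooth_fun U (fun p => g p (s p) (t p))].

Definition is_connection {R : realType} {M : surface R} (V : M -> lmodType R)
    (sm : set M -> section V -> Prop)
    (nab : forall p : M, tangent p -> section V -> V p) : Prop :=
  [/\ forall (U : set M) p v s t, open U -> U p ->
        (forall q, U q -> s q = t q) -> nab p v s = nab p v t,
      forall p a (v w : tangent p) s,
        nab p (a *: v + w) s = a *: nab p v s + nab p w s,
      forall U p v s t, open U -> U p -> sm U s -> sm U t ->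
        nab p v (fun q => s q + t q) = nab p v s + nab p v t,
      forall U p v f s, open U -> U p -> smooth_fun U f -> sm U s ->
        nab p v (fun q => f q *: s q) = dfun f v *: s p + f p *: nab p v s
    & forall U X s, open U -> smooth_vf U X -> sm U s ->
        sm U (fun p => nab p (X p) s)].

Definition metric_compatible {R : realType} {M : surface R}
    (V : M -> lmodType R) (sm : set M -> section V -> Prop)
    (g : forall p, V p -> V p -> R)
    (nab : forall p : M, tangent p -> section V -> V p) : Prop :=
  forall U p v s t, open U -> U p -> sm U s -> sm U t ->
    dfun (fun q => g q (s q) (t q)) v =
    g p (nab p v s) (t p) + g p (s p) (nab p v t).

(* The bracket [X, Y] is the operator f |-> X(Y f) - Y(X f). *)
Definition torsion_free {R : realType} {M : surface R}
    (nab : forall p : M, tangent p -> section (@tangent R M) -> tangent p) :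
    Prop :=
  forall U p X Y f, open U -> U p -> smooth_vf U X -> smooth_vf U Y ->
    smooth_fun U f ->
    dfun f (nab p (X p) Y - nab p (Y p) X) =
    dfun (fun q => dfun f (Y q)) (X p) - dfun (fun q => dfun f (X q)) (Y p).

Record riemannian (R : realType) (M : surface R) := Riemannian {
  rmetric : forall p : M, tangent p -> tangent p -> R;
  levi_civita : forall p : M, tangent p -> section (@tangent R M) -> tangent p;
  rmetricP : is_metric (@smooth_vf R M) rmetric;
  rmetric_pos : forall p (v : tangent p), v != 0 -> 0 < rmetric v v;
  levi_civitaP : is_connection (@smooth_vf R M) levi_civita;
  levi_civita_metric : metric_compatible (@smooth_vf R M) rmetric levi_civita;
  levi_civita_torsion_free : torsion_free levi_civita
}.

(* The timelike (eps = -1) or spacelike (eps = 1) vectors of a fibre of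
   signature (1,1) form two opposite open cones; O selects one of them,
   continuously in the base point. *)
Definition cone_orientation {R : realType} {M : surface R}
    (V : M -> lmodType R) (sm : set M -> section V -> Prop)
    (g : forall p, V p -> V p -> R) (eps : R) (O : forall p, set (V p)) :
    Prop :=
  [/\ forall p u, O p u -> 0 < eps * g p u u,
      forall p u, 0 < eps * g p u u -> O p u \/ O p (- u),
      forall p u v, O p u -> 0 < eps * g p v v -> (O p v <-> 0 < eps * g p u v)
    & forall p, exists U s,
        [/\ open U, U p, sm U s & forall q, U q -> O q (s q)]].

Record lorentz_bundle (R : realType) (M : surface R) := LorentzBundle {
  fibre :> M -> lmodType R;
  smooth_sec : set M -> section fibre -> Prop;
  emetric : forall p, fibre p -> fibre p -> R;
  econn : forall p : M, tangent p -> section fibre -> fibre p;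
  future : forall p, set (fibre p);
  rightward : forall p, set (fibre p);
  fibreP : is_bundle2 smooth_sec;
  emetricP : is_metric smooth_sec emetric;
  emetric_sign : forall p, exists u v : fibre p,
    [/\ emetric u u = -1, emetric v v = 1 & emetric u v = 0];
  econnP : is_connection smooth_sec econn;
  econn_metric : metric_compatible smooth_sec emetric econn;
  futureP : cone_orientation smooth_sec emetric (-1) future;
  rightwardP : cone_orientation smooth_sec emetric 1 rightward
}.

Definition Q1 {R : realType} {M : surface R} (E : lorentz_bundle M) (p : M) :
    set (E p * E p) :=
  [set e | [/\ emetric e.1 e.1 = -1, emetric e.2 e.2 = 1, emetric e.1 e.2 = 0,
               future e.1 & rightward e.2]].

Definition Q2 {R : realType} {M : surface R} (g : riemannian M) (p : M) :
    set (tangent p * tangent p) :=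
  [set e | [/\ rmetric g e.1 e.1 = 1, rmetric g e.2 e.2 = 1,
               rmetric g e.1 e.2 = 0
             & 0 < \det (col_mx (e.1 : 'rV[R]_2) (e.2 : 'rV[R]_2) : 'M[R]_2)]].

(* A principal G-bundle, given by its fibres and its smooth local sections,
   with an equivariant bundle map spin_frame to the frame bundle Q.  A frame
   is viewed as a linear isomorphism from the plane of the coordinates
   iota x y in R13, on which g in G acts by xi |-> g xi (hhat g)^-1, and
   spin_frame (s g) = spin_frame s \o g. *)
Record spin_structure (R : realType) (M : surface R) (V : M -> lmodType R)
    (sm : set M -> section V -> Prop) (Q : forall p, set (V p * V p))
    (G : set (HC R)) (iota : R -> R -> HC R) := SpinStructure {
  spin_fibre :> M -> Type;
  spin_pt : forall p, spin_fibre p;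
  spin_act : forall p, spin_fibre p -> HC R -> spin_fibre p;
  spin_frame : forall p, spin_fibre p -> V p * V p;
  spin_smooth : set M -> (forall p, spin_fibre p) -> Prop;
  spin_act1 : forall p (s : spin_fibre p), spin_act s hone = s;
  spin_actM : forall p (s : spin_fibre p) g h, G g -> G h ->
    spin_act (spin_act s g) h = spin_act s (hmul g h);
  spin_torsor : forall p (s s' : spin_fibre p),
    exists! g, G g /\ s' = spin_act s g;
  spin_smooth_local : is_local spin_smooth;
  spin_smooth_ex : forall p, exists U s, [/\ open U, U p & spin_smooth U s];
  spin_smooth_torsor : forall U s s' (g : M -> HC R), open U ->
    spin_smooth U s -> (forall p, U p -> G (g p)) ->
    (forall p, U p -> s' p = spin_act (s p) (g p)) ->
    (spin_smooth U s' <-> smooth_hc U g);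
  spin_frameP : forall p (s : spin_fibre p), Q p (spin_frame s);
  spin_frame_act : forall p (s : spin_fibre p) g x y x' y', G g ->
    iota x' y' = hmul (hmul g (iota x y)) (hinv (hhat g)) ->
    x *: (spin_frame (spin_act s g)).1 + y *: (spin_frame (spin_act s g)).2 =
    x' *: (spin_frame s).1 + y' *: (spin_frame s).2;
  spin_frame_smooth : forall U s, open U -> spin_smooth U s ->
    sm U (fun p => (spin_frame (s p)).1) /\ sm U (fun p => (spin_frame (s p)).2)
}.

Definition spin_structure_E (R : realType) (M : surface R)
    (E : lorentz_bundle M) :=
  spin_structure (@smooth_sec R M E) (@Q1 R M E) Spin11
    (fun x y => mink x y 0 0).

Definition spin_structure_M (R : realType) (M : surface R)
    (g : riemannian M) :=
  spin_structure (@smooth_vf R M) (@Q2 R M g) Spin2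
    (fun x y => mink 0 0 x y).

(* The fibre of the bundle associated with S1 x_M S2 is the space of maps psi
   with psi (s1 g1) (s2 g2) = (g1 g2)^-1 psi s1 s2: psi s1 s2 is the coordinate
   of psi in (s1, s2).  Equivariance is part of [is_spinor_at]. *)
Definition Sigma {R : realType} {M : surface R} {g : riemannian M}
    {E : lorentz_bundle M} (S1 : spin_structure_E E) (S2 : spin_structure_M g)
    (p : M) := S1 p -> S2 p -> HC R.

Definition is_spinor_at {R : realType} {M : surface R} {g : riemannian M}
    {E : lorentz_bundle M} {S1 : spin_structure_E E} {S2 : spin_structure_M g}
    (p : M) (psi : Sigma S1 S2 p) : Prop :=
  forall s1 s2 g1 g2, Spin11 g1 -> Spin2 g2 ->
    psi (spin_act s1 g1) (spin_act s2 g2) =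
    hmul (hinv (hmul g1 g2)) (psi s1 s2).

Definition is_spinor_field {R : realType} {M : surface R} {g : riemannian M}
    {E : lorentz_bundle M} {S1 : spin_structure_E E} {S2 : spin_structure_M g}
    (phi : forall p, Sigma S1 S2 p) : Prop :=
  (forall p, is_spinor_at (phi p)) /\
  (forall U s1 s2, open U -> spin_smooth U s1 -> spin_smooth U s2 ->
     smooth_hc U (fun p => phi p (s1 p) (s2 p))).

(* Components of u + w in the orthonormal frame lying under (s1, s2). *)
Definition vcoord {R : realType} {M : surface R} {g : riemannian M}
    {E : lorentz_bundle M} {S1 : spin_structure_E E} {S2 : spin_structure_M g}
    (p : M) (X : E p * tangent p) (s1 : S1 p) (s2 : S2 p) : HC R :=
  mink (- emetric X.1 (spin_frame s1).1) (emetric X.1 (spin_frame s1).2)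
       (rmetric g X.2 (spin_frame s2).1) (rmetric g X.2 (spin_frame s2).2).

Definition clifford {R : realType} {M : surface R} {g : riemannian M}
    {E : lorentz_bundle M} {S1 : spin_structure_E E} {S2 : spin_structure_M g}
    (p : M) (X : E p * tangent p) (psi : Sigma S1 S2 p) : Sigma S1 S2 p :=
  fun s1 s2 => hmul (vcoord X s1 s2) (hhat (psi s1 s2)).

(* Right multiplication by I. *)
Definition spinor_i {R : realType} {M : surface R} {g : riemannian M}
    {E : lorentz_bundle M} {S1 : spin_structure_E E} {S2 : spin_structure_M g}
    (p : M) (psi : Sigma S1 S2 p) : Sigma S1 S2 p :=
  fun s1 s2 => hmul (psi s1 s2) hI.

(* On spinors (equivariant maps) the next two do not depend on the point of
   S1 x_M S2 at which the coordinates are taken. *)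
Definition spinor_form {R : realType} {M : surface R} {g : riemannian M}
    {E : lorentz_bundle M} {S1 : spin_structure_E E} {S2 : spin_structure_M g}
    (p : M) (psi psi' : Sigma S1 S2 p) : R[i] :=
  hform (psi (spin_pt S1 p) (spin_pt S2 p)) (psi' (spin_pt S1 p) (spin_pt S2 p)).

Definition spinor_pairing {R : realType} {M : surface R} {g : riemannian M}
    {E : lorentz_bundle M} {S1 : spin_structure_E E} {S2 : spin_structure_M g}
    (p : M) (psi psi' : Sigma S1 S2 p) : HC R :=
  hmul (hbar (psi' (spin_pt S1 p) (spin_pt S2 p)))
       (psi (spin_pt S1 p) (spin_pt S2 p)).

(* If nab e0 = w e1, nab e1 = w e0, nab e2 = t e3 and nab e3 = - t e2, the
   connection form of the frame is the image of the following element under the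
   differential of the covering g |-> (xi |-> g xi (hhat g)^-1). *)
Definition spin_conn_form {R : realType} (w t : R) : HC R :=
  quat 0 ((t / 2) -i* (w / 2)) 0 0.

Lemma spin_conn_formE (R : realType) (w t x0 x1 x2 x3 : R) :
  hmul (spin_conn_form w t) (mink x0 x1 x2 x3) -
  hmul (mink x0 x1 x2 x3) (hhat (spin_conn_form w t)) =
  mink (w * x1) (w * x0) (- (t * x3)) (t * x2).
Proof.
apply/rowP => -[[|[|[|[|//]]]] hk]; rewrite !mxE /=; apply/eqP;
  rewrite eq_complex /=; apply/andP; split; apply/eqP; by field.
Qed.

(* The coordinate at p, in the local section (s1, s2), of nab_X phi. *)
Definition nabla_coord {R : realType} {M : surface R} {g : riemannian M}
    {E : lorentz_bundle M} {S1 : spin_structure_E E} {S2 : spin_structure_M g}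
    (phi : forall p, Sigma S1 S2 p) (s1 : forall p, S1 p) (s2 : forall p, S2 p)
    (p : M) (X : tangent p) : HC R :=
  dhc (fun q => phi q (s1 q) (s2 q)) X +
  hmul
    (spin_conn_form
       (emetric (econn X (fun q => (spin_frame (s1 q)).1))
                (spin_frame (s1 p)).2)
       (rmetric g (levi_civita g X (fun q => (spin_frame (s2 q)).1))
                  (spin_frame (s2 p)).2))
    (phi p (s1 p) (s2 p)).

(* The coordinate at p, in (s1, s2), of D phi. *)
Definition dirac_coord {R : realType} {M : surface R} {g : riemannian M}
    {E : lorentz_bundle M} {S1 : spin_structure_E E} {S2 : spin_structure_M g}
    (phi : forall p, Sigma S1 S2 p) (s1 : forall p, S1 p) (s2 : forall p, S2 p)
    (p : M) : HC R :=
  let e2 := (spin_frame (s2 p)).1 in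
  let e3 := (spin_frame (s2 p)).2 in
  hmul (vcoord (0, e2) (s1 p) (s2 p)) (hhat (nabla_coord phi s1 s2 e2)) +
  hmul (vcoord (0, e3) (s1 p) (s2 p)) (hhat (nabla_coord phi s1 s2 e3)).

Definition dirac_equation {R : realType} {M : surface R} {g : riemannian M}
    {E : lorentz_bundle M} {S1 : spin_structure_E E} {S2 : spin_structure_M g}
    (Hvec : section E) (phi : forall p, Sigma S1 S2 p) : Prop :=
  forall U s1 s2 p, open U -> spin_smooth U s1 -> spin_smooth U s2 -> U p ->
    dirac_coord phi s1 s2 p = clifford (Hvec p, 0) (phi p) (s1 p) (s2 p).

Definition immersion_of {R : realType} {M : surface R} {g : riemannian M}
    {E : lorentz_bundle M} {S1 : spin_structure_E E} {S2 : spin_structure_M g}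
    (phi : forall p, Sigma S1 S2 p) (F : M -> HC R) : Prop :=
  [/\ forall p, R13 (F p), smooth_hc setT F
    & forall p (X : tangent p),
        dhc F X = spinor_pairing (clifford (0, X) (phi p)) (phi p)].

Definition belongs_to {R : realType} {M : surface R} (F : M -> HC R)
    (A : set (HC R)) : Prop :=
  exists c, R13 c /\ forall p, A (F p + c).

Definition parallel_frame {R : realType} {M : surface R}
    (E : lorentz_bundle M) (e0 e1 : section E) : Prop :=
  [/\ smooth_sec setT e0, smooth_sec setT e1, forall p, Q1 (e0 p, e1 p),
      forall p (X : tangent p), econn X e0 = 0
    & forall p (X : tangent p), econn X e1 = 0].

Definition condition_R3 {R : realType} {M : surface R} {g : riemannian M}
    {E : lorentz_bundle M} {S1 : spin_structure_E E} {S2 : spin_structure_M g}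
    (Hvec : section E) (phi : forall p, Sigma S1 S2 p) (e0 e1 : section E) :
    Prop :=
  (exists H : M -> R, forall p, Hvec p = H p *: e1 p) /\
  (forall p (e2 e3 : tangent p), Q2 g (e2, e3) ->
     clifford (e1 p, 0) (phi p) =
     clifford (0, e2) (clifford (0, e3) (phi p))).

Definition condition_R12 {R : realType} {M : surface R} {g : riemannian M}
    {E : lorentz_bundle M} {S1 : spin_structure_E E} {S2 : spin_structure_M g}
    (Hvec : section E) (phi : forall p, Sigma S1 S2 p) (e0 e1 : section E) :
    Prop :=
  (exists H : M -> R, forall p, Hvec p = H p *: e0 p) /\
  ((forall p s1 s2,
      clifford (e1 p, 0) (phi p) s1 s2 = spinor_i (phi p) s1 s2) \/
   (forall p s1 s2,
      clifford (e1 p, 0) (phi p) s1 s2 = - spinor_i (phi p) s1 s2)).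

Definition condition_H3 {R : realType} {M : surface R} {g : riemannian M}
    {E : lorentz_bundle M} {S1 : spin_structure_E E} {S2 : spin_structure_M g}
    (Hvec : section E) (phi : forall p, Sigma S1 S2 p) (e0 e1 : section E) :
    Prop :=
  (exists H : M -> R, forall p, Hvec p = e0 p + H p *: e1 p) /\
  (forall p (X : tangent p),
     dhc (fun q => spinor_pairing (clifford (e0 q, 0) (phi q)) (phi q)) X =
     spinor_pairing (clifford (0, X) (phi p)) (phi p)).

(* Main.v *)
Require Import Defs.
From mathcomp Require Import ring lra.

(** For a spinor of norm 1 with coordinate [q], the vector defined by
    [X] in [E + TM] is [qbar [X] qhat], and [X |-> qbar [X] qhat] is an isometry of
    [E + TM] onto the Minkowski space which preserves the future ([spin_vec_form],
    [spin_vec_surj], [spin_vec_future]).  Its restriction to [TM] is [dF]; its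
    restriction to [E] identifies [E] with the normal bundle.

    Write [nabla_X phi = eta(X) phi].  Since [phi] has norm 1 the scalar part of [eta]
    vanishes, and the Dirac equation kills its [I]-part and prescribes the trace of
    what remains ([dirac_eta]).  Consequently, if [Y] is a parallel section of [E] and
    [N] the vector field defined by [Y], then [dN] takes tangent values and
    [sum_j H(dN(e_j), dF(e_j)) = - 2 <H, Y>], where [H] is the mean curvature vector
    ([parallel_dhc_tangent], [parallel_dhc_trace]).

    The condition on the spinor for [R^3] says that [e0] defines the constant vector
    [i1], and the one for [R^{1,2}] that [e1] defines [I] or [-I] ([condition_R3_at],
    [condition_R12_at]); then [dF] is orthogonal to a fixed vector, and [F] stays in a
    hyperplane.  The condition for [H^3] says that [F] differs by a constant from the
    field defined by [e0], which lies in the hyperbolic space.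

    Conversely, let [G] be [i1], [I], or the translate of [F] in the hyperbolic space.
    It is a normal field with tangent differential, so its products with the fields of
    [e0] and [e1] have zero derivative: [G] is defined by [x e0 + y e1] for constants
    [x], [y] ([normal_constant]), and this section completes to a parallel frame.  The
    trace identity for [G] gives the form of the mean curvature vector. *)

Set Implicit Arguments.
Unset Strict Implicit.
Unset Printing Implicit Defensive.

Import Order.TTheory GRing.Theory Num.Theory.
Import numFieldNormedType.Exports.

Local Open Scope classical_set_scope.
Local Open Scope complex_scope.
Local Open Scope ring_scope.

(** * Algebra of the complex quaternions *)

Lemma forall_ord4 (P : 'I_4 -> Prop) : P 0 -> P 1 -> P 2 -> P 3 -> forall k, P k.
Proof.
move=> h0 h1 h2 h3 [[|[|[|[|//]]]] hk].
- by have -> : Ordinal hk = 0 by exact/val_inj.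
- by have -> : Ordinal hk = 1 by exact/val_inj.
- by have -> : Ordinal hk = 2 by exact/val_inj.
- by have -> : Ordinal hk = 3 by exact/val_inj.
Qed.

Section Quaternions.
Context {R : realType}.
Implicit Types p q r : HC R.

Lemma quatE (a b c d : R[i]) :
  (quat a b c d 0 0 = a) * (quat a b c d 0 1 = b) *
  (quat a b c d 0 2 = c) * (quat a b c d 0 3 = d).
Proof. by rewrite !mxE. Qed.

Lemma rV4P (T : Type) (u v : 'rV[T]_4) :
  u 0 0 = v 0 0 -> u 0 1 = v 0 1 -> u 0 2 = v 0 2 -> u 0 3 = v 0 3 -> u = v.
Proof. by move=> h0 h1 h2 h3; apply/rowP; exact: forall_ord4. Qed.

Lemma quat_eta q : q = quat (q 0 0) (q 0 1) (q 0 2) (q 0 3).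
Proof. by apply: rV4P; rewrite quatE. Qed.

Lemma quatP (P : HC R -> Prop) : (forall a b c d, P (quat a b c d)) -> forall q, P q.
Proof. by move=> H q; rewrite (quat_eta q). Qed.

Lemma hmul_quat (a b c d a' b' c' d' : R[i]) :
  hmul (quat a b c d) (quat a' b' c' d') =
  quat (a * a' - b * b' - c * c' - d * d') (a * b' + b * a' + c * d' - d * c')
       (a * c' - b * d' + c * a' + d * b') (a * d' + b * c' - c * b' + d * a').
Proof. by rewrite /hmul !quatE. Qed.

Lemma hbar_quat (a b c d : R[i]) : hbar (quat a b c d) = quat a (- b) (- c) (- d).
Proof. by rewrite /hbar !quatE. Qed.

Lemma hhat_quat (a b c d : R[i]) :
  hhat (quat a b c d) = quat (conjc a) (conjc b) (conjc c) (conjc d).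
Proof. by apply: rV4P; rewrite mxE !quatE. Qed.

Lemma hformE q r :
  hform q r = q 0 0 * r 0 0 + q 0 1 * r 0 1 + q 0 2 * r 0 2 + q 0 3 * r 0 3.
Proof.
rewrite /hform !big_ord_recl big_ord0 addr0 !addrA.
by congr (_ + _ + _ + _); congr (q 0 _ * r 0 _); exact/val_inj.
Qed.

Lemma addq (a b c d a' b' c' d' : R[i]) :
  quat a b c d + quat a' b' c' d' = quat (a + a') (b + b') (c + c') (d + d').
Proof. by apply: rV4P; rewrite mxE !quatE. Qed.

Lemma oppq (a b c d : R[i]) : - quat a b c d = quat (- a) (- b) (- c) (- d).
Proof. by apply: rV4P; rewrite mxE !quatE. Qed.

Lemma scaleq (k a b c d : R[i]) :
  k *: quat a b c d = quat (k * a) (k * b) (k * c) (k * d).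
Proof. by apply: rV4P; rewrite mxE !quatE. Qed.

Lemma eq_quat (a b c d a' b' c' d' : R[i]) :
  a = a' -> b = b' -> c = c' -> d = d' -> quat a b c d = quat a' b' c' d'.
Proof. by move=> -> -> -> ->. Qed.

Lemma hmulA : associative (@hmul R).
Proof.
elim/quatP=> a b c d; elim/quatP=> a' b' c' d'; elim/quatP=> x y z t.
by rewrite !hmul_quat; apply: eq_quat; ring.
Qed.

Lemma hmulDl : left_distributive (@hmul R) +%R.
Proof.
elim/quatP=> a b c d; elim/quatP=> a' b' c' d'; elim/quatP=> x y z t.
by rewrite addq !hmul_quat addq; apply: eq_quat; ring.
Qed.

Lemma hmulDr : right_distributive (@hmul R) +%R.
Proof.
elim/quatP=> a b c d; elim/quatP=> a' b' c' d'; elim/quatP=> x y z t.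
by rewrite addq !hmul_quat addq; apply: eq_quat; ring.
Qed.

Lemma hmulZl k q r : hmul (k *: q) r = k *: hmul q r.
Proof.
elim/quatP: q=> a b c d; elim/quatP: r=> a' b' c' d'.
by rewrite scaleq !hmul_quat scaleq; apply: eq_quat; ring.
Qed.

Lemma hmulZr k q r : hmul q (k *: r) = k *: hmul q r.
Proof.
elim/quatP: q=> a b c d; elim/quatP: r=> a' b' c' d'.
by rewrite scaleq !hmul_quat scaleq; apply: eq_quat; ring.
Qed.

Lemma hmulNl q r : hmul (- q) r = - hmul q r.
Proof. by rewrite -(scaleN1r q) hmulZl scaleN1r. Qed.

Lemma hmulNr q r : hmul q (- r) = - hmul q r.
Proof. by rewrite -(scaleN1r r) hmulZr scaleN1r. Qed.

Lemma hmul1q q : hmul hone q = q.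
Proof. by elim/quatP: q=> a b c d; rewrite hmul_quat; apply: eq_quat; ring. Qed.

Lemma hmulq1 q : hmul q hone = q.
Proof. by elim/quatP: q=> a b c d; rewrite hmul_quat; apply: eq_quat; ring. Qed.

Lemma hbarK : involutive (@hbar R).
Proof. by elim/quatP=> a b c d; rewrite !hbar_quat !opprK. Qed.

Lemma hbarM q r : hbar (hmul q r) = hmul (hbar r) (hbar q).
Proof.
elim/quatP: q=> a b c d; elim/quatP: r=> a' b' c' d'.
by rewrite !(hmul_quat, hbar_quat); apply: eq_quat; ring.
Qed.

Lemma hbarN q : hbar (- q) = - hbar q.
Proof. by elim/quatP: q=> a b c d; rewrite oppq !hbar_quat oppq. Qed.

Lemma hbarD q r : hbar (q + r) = hbar q + hbar r.
Proof.
elim/quatP: q=> a b c d; elim/quatP: r=> a' b' c' d'.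
by rewrite addq !hbar_quat addq !opprD.
Qed.

Lemma hhatK : involutive (@hhat R).
Proof. by move=> q; apply: rV4P; rewrite !mxE conjcK. Qed.

Lemma hhatM q r : hhat (hmul q r) = hmul (hhat q) (hhat r).
Proof.
elim/quatP: q=> a b c d; elim/quatP: r=> a' b' c' d'.
by rewrite !(hmul_quat, hhat_quat); apply: eq_quat;
  rewrite !(rmorphD, rmorphN, rmorphM).
Qed.

Lemma hhatN q : hhat (- q) = - hhat q.
Proof. by apply: rV4P; rewrite !mxE rmorphN. Qed.

Lemma hhatD q r : hhat (q + r) = hhat q + hhat r.
Proof. by apply: rV4P; rewrite !mxE rmorphD. Qed.

Lemma hhat_bar q : hhat (hbar q) = hbar (hhat q).
Proof. by elim/quatP: q=> a b c d; rewrite !(hhat_quat, hbar_quat) !rmorphN. Qed.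

Lemma hbarq q : hmul (hbar q) q = hform q q *: hone.
Proof.
by elim/quatP: q=> a b c d; rewrite /hone hbar_quat hmul_quat hformE scaleq !quatE; apply: eq_quat; ring.
Qed.

Lemma hqbar q : hmul q (hbar q) = hform q q *: hone.
Proof.
by elim/quatP: q=> a b c d; rewrite /hone hbar_quat hmul_quat hformE scaleq !quatE; apply: eq_quat; ring.
Qed.

Lemma hformC q r : hform q r = hform r q.
Proof. by rewrite !hformE; ring. Qed.

Lemma hformDl q r s : hform (q + r) s = hform q s + hform r s.
Proof. by rewrite !hformE !mxE; ring. Qed.

Lemma hformZl k q r : hform (k *: q) r = k * hform q r.
Proof. by rewrite !hformE !mxE; ring. Qed.

Lemma hformNl q r : hform (- q) r = - hform q r.
Proof. by rewrite -(scaleN1r q) hformZl mulN1r. Qed.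

Lemma hformNr q r : hform r (- q) = - hform r q.
Proof. by rewrite hformC hformNl (hformC q). Qed.

Lemma hform0l q : hform 0 q = 0.
Proof. by rewrite -(scale0r 0) hformZl mul0r. Qed.

Lemma hformMl q r s : hform (hmul s q) (hmul s r) = hform s s * hform q r.
Proof.
elim/quatP: q=> a b c d; elim/quatP: r=> a' b' c' d'; elim/quatP: s=> x y z t.
by rewrite !hmul_quat !hformE !quatE; ring.
Qed.

Lemma hformMr q r s : hform (hmul q s) (hmul r s) = hform q r * hform s s.
Proof.
elim/quatP: q=> a b c d; elim/quatP: r=> a' b' c' d'; elim/quatP: s=> x y z t.
by rewrite !hmul_quat !hformE !quatE; ring.
Qed.

Lemma hform_hat q r : hform (hhat q) (hhat r) = conjc (hform q r).
Proof. by rewrite !hformE !mxE !(rmorphD, rmorphM). Qed.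

Lemma hform_bar q r : hform (hbar q) (hbar r) = hform q r.
Proof.
elim/quatP: q=> a b c d; elim/quatP: r=> a' b' c' d'.
by rewrite !hbar_quat !hformE !quatE; ring.
Qed.

End Quaternions.

(** * Calculus on a surface *)

Lemma near_eq_is_diff (R : numFieldType) (V W : normedModType R)
    (f g : V -> W) (x : V) :
  {near x, f =1 g} -> differentiable f x ->
  differentiable g x /\ 'd g x = 'd f x :> (V -> W).
Proof.
move=> fg df; have fgx := nbhs_singleton fg.
have cf := diff_continuous df.
have gE : g \o shift x = cst (g x) + 'd f x +o_ (0 : V) id.
  apply/eqaddoP => e e0.
  have := diff_locally df => /eqaddoP /(_ e e0).
  apply: filter_app.
  have : \forall y \near (0 : V), f (y + x) = g (y + x).
    have : \forall y \near x, f y = g y by [].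
    by rewrite (near_shift 0) subr0.
  apply: filter_app; near=> y => fgy.
  by rewrite !fctE /= fgy fgx.
have dg := diff_unique cf gE.
by split => //; apply/diff_locallyP; rewrite dg.
Unshelve. all: by end_near. Qed.

(** The mean value theorem on the segments of a ball. *)
Lemma zero_diff_locally_cst (R : realType) (V : normedModType R) (f : V -> R)
    (x : V) :
  (\forall y \near x, differentiable f y /\ forall v, 'd f y v = 0) ->
  \forall y \near x, f y = f x.
Proof.
move=> /nbhs_ballP[r /= r0 Hr]; apply/nbhs_ballP; exists r => //= y xy.
pose h (t : R) := f (x + t *: (y - x)).
have inb (t : R) : t \in `[0, 1] -> ball x r (x + t *: (y - x)).
  rewrite in_itv /= => /andP[t0 t1].
  rewrite -ball_normE /= opprD addrA subrr sub0r normrN normrZ ger0_norm //.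
  apply: le_lt_trans (_ : `|y - x| < r).
    by rewrite -[leRHS]mul1r ler_wpM2r.
  by move: xy; rewrite -ball_normE /= distrC.
have dh (t : R) : t \in `[0, 1] -> is_derive t (1 : R) h 0.
  move=> /inb /Hr [df f0].
  have dl : is_diff t (fun t : R => x + t *: (y - x))
      (cst 0 + (fun t : R => t *: (y - x))).
    exact: is_diffD.
  have dc := is_diff_comp dl (differentiableP df).
  have dh : differentiable h t by apply: (@ex_diff _ _ _ _ _ _ _ dc).
  apply: DeriveDef; first exact: diff_derivable.
  rewrite deriveE //.
  have -> : 'd h t = 'd (f \o (fun t : R => x + t *: (y - x))) t by [].
  by rewrite diff_val /= f0.
have h01 : h 1 = h 0.
  have hc : {within `[0, 1], continuous h}.
    apply: derivable_within_continuous => t tt.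
    exact: (@ex_derive _ _ _ _ _ _ _ (dh t tt)).
  have dho (t : R) : t \in `]0, 1[ -> is_derive t (1 : R) h ((fun=> 0) t).
    by move=> /subset_itv_oo_cc; exact: dh.
  have [c _] := MVT ltr01 dho hc.
  by rewrite mul0r => /eqP; rewrite subr_eq0 => /eqP.
by move: h01; rewrite /h scale1r scale0r addr0 addrC subrK.
Qed.

(** Differentials are taken in the chart centred at the point, as in [dfun]. *)
Definition diff_at {R : realType} {M : surface R} (f : M -> R) (p : M) : Prop :=
  differentiable (f \o chart_inv p) (chart p p).

Lemma near_chart_inv {R : realType} {M : surface R} (p q : M) (P : set M) :
  dom p q -> (\near q, P q) -> \forall x \near chart p q, P (chart_inv p x).
Proof.
move=> pq Pq.
have : {for chart p q, continuous (chart_inv p)}.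
  by apply: chart_inv_continuous; exists q.
by move=> /(_ P); rewrite /= chartK //; apply.
Qed.

Lemma smooth_fun_diff {R : realType} {M : surface R} (U : set M) (f : M -> R)
    (p : M) : smooth_fun U f -> U p -> diff_at f p.
Proof.
move=> /(_ p 1%N) [+ _] Up; apply.
by exists p => //; split => //; exact: dom_center.
Qed.

Lemma diff_at_cst {R : realType} {M : surface R} (a : R) (p : M) :
  diff_at (fun=> a) p.
Proof. exact: differentiable_cst. Qed.

Lemma dfun_cst {R : realType} {M : surface R} (a : R) (p : M)
  (v : tangent p) : dfun (fun=> a) v = 0.
Proof. by rewrite /dfun (_ : _ \o _ = cst a) // diff_cst. Qed.

Section Rules.
Context {R : realType} {M : surface R} (p : M).
Implicit Types f h : M -> R.

Lemma diff_atD f h : diff_at f p -> diff_at h p ->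
  diff_at (fun q => f q + h q) p.
Proof. exact: differentiableD. Qed.

Lemma diff_atN f : diff_at f p -> diff_at (fun q => - f q) p.
Proof. exact: differentiableN. Qed.

Lemma diff_atM f h : diff_at f p -> diff_at h p ->
  diff_at (fun q => f q * h q) p.
Proof. exact: differentiableM. Qed.

Lemma dfunD f h (v : tangent p) : diff_at f p -> diff_at h p ->
  dfun (fun q => f q + h q) v = dfun f v + dfun h v.
Proof. by move=> df dh; have := congr1 (@^~ v) (diffD df dh). Qed.

Lemma dfunN f (v : tangent p) : diff_at f p ->
  dfun (fun q => - f q) v = - dfun f v.
Proof. by move=> df; have := congr1 (@^~ v) (diffN df). Qed.

Lemma dfunM f h (v : tangent p) : diff_at f p -> diff_at h p ->
  dfun (fun q => f q * h q) v = f p * dfun h v + h p * dfun f v.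
Proof.
move=> df dh; have /= := congr1 (@^~ v) (diffM df dh).
by rewrite chartK; last exact: dom_center.
Qed.

End Rules.

Lemma dfun_linear {R : realType} {M : surface R} (f : M -> R) (p : M) a
  (v w : tangent p) : dfun f (a *: v + w) = a * dfun f v + dfun f w.
Proof. by rewrite /dfun linearP. Qed.

(** The chart in which a differential is taken changes with the point, so the
    chain rule for a transition map is needed before the mean value theorem. *)
Lemma zero_dfun_locally_cst {R : realType} {M : surface R} (f : M -> R)
    (p : M) :
  (forall q, diff_at f q /\ forall v : tangent q, dfun f v = 0) ->
  \forall q \near p, f q = f p.
Proof.
move=> f0.
have : \forall x \near chart p p, f (chart_inv p x) = f (chart_inv p (chart p p)).
  apply: (@zero_diff_locally_cst _ _ (f \o chart_inv p)).
  have : \forall x \near chart p p, (chart p @` dom p) x.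
    apply: (@open_nbhs_nbhs _ (chart p p)); split; first exact: chart_open.
    by exists p => //; exact: dom_center.
  apply: filterS => _ [q pq <-].
  have dt : differentiable (chart q \o chart_inv p) (chart p q).
    have [dt _] := @transition_smooth _ M p q 1%N; apply: dt.
    by exists q => //; split => //; exact: dom_center.
  have [dfq dfq0] := f0 q.
  have Eq : (chart q \o chart_inv p) (chart p q) = chart q q by rewrite /= chartK.
  have dfq' : differentiable (f \o chart_inv q)
      ((chart q \o chart_inv p) (chart p q)) by rewrite Eq.
  have fE : {near chart p q,
      (f \o chart_inv q) \o (chart q \o chart_inv p) =1 f \o chart_inv p}.
    have : \forall r \near q, dom q r.
      by apply: open_nbhs_nbhs; split; [exact: dom_open|exact: dom_center].
    move=> /(near_chart_inv pq); apply: filterS => x qx.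
    by rewrite /= chartK.
  have [df dfE] := near_eq_is_diff fE (differentiable_comp dt dfq').
  split; [exact: df|move=> v].
  rewrite dfE (diff_comp dt dfq') [LHS]/=.
  by rewrite chartK //; exact: dfq0.
rewrite chartK; last exact: dom_center.
move=> H; near=> q.
have pq : dom p q.
  near: q; apply: open_nbhs_nbhs; split; [exact: dom_open|exact: dom_center].
rewrite -(chartK pq); near: q.
by have /(_ _ H) := chart_continuous (dom_center p).
Unshelve. all: by end_near. Qed.

(** The level sets of such a function are open and closed, and a path is connected. *)
Lemma zero_dfun_cst {R : realType} {M : surface R} (f : M -> R) :
  path_connected (R := R) M ->
  (forall q, diff_at f q /\ forall v : tangent q, dfun f v = 0) ->
  forall x y, f x = f y.
Proof.
move=> Mc f0 x y; have [c [cc cx cy]] := Mc x y.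
have Ac : connected (c @` `[0, 1]).
  exact: connected_continuous_connected (@segment_connected _ _ _) cc.
pose B a := [set q | f q = a].
have oB (P : set R) : open (f @^-1` P).
  rewrite openE => q /= Pq; have := zero_dfun_locally_cst q f0.
  by rewrite /interior; apply: filterS => z /= ->.
have Ax : (c @` `[0, 1]) x by exists 0 => //=; rewrite in_itv /= lexx ler01.
have Ay : (c @` `[0, 1]) y by exists 1 => //=; rewrite in_itv /= lexx ler01.
suff : c @` `[0, 1] `&` (f @^-1` [set f x]) = c @` `[0, 1].
  by move=> AE; move: Ay; rewrite -AE => -[_ /= ->].
apply: Ac; first by exists x.
  by exists (f @^-1` [set f x]).
exists (f @^-1` [set f x]) => //.
by have := oB (~` [set f x]); rewrite -preimage_setC => /open_closedC; rewrite setCK.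
Qed.

(** * Differentials of quaternion-valued functions *)

(* Unification must not unfold differentials when it matches the rules above. *)
#[local] Opaque diff_at dfun.

Section ComplexCalculus.
Context {R : realType} {M : surface R}.
Implicit Types f h : M -> R[i].

Definition cdiff_at f (p : M) : Prop :=
  diff_at (fun q => complex.Re (f q)) p /\ diff_at (fun q => complex.Im (f q)) p.

Definition dcplx f (p : M) (v : tangent p) : R[i] :=
  dfun (fun q => complex.Re (f q)) v +i* dfun (fun q => complex.Im (f q)) v.

Lemma ReM (x y : R[i]) : complex.Re (x * y) =
  complex.Re x * complex.Re y + - (complex.Im x * complex.Im y).
Proof. by case: x; case: y. Qed.

Lemma ImM (x y : R[i]) : complex.Im (x * y) =
  complex.Re x * complex.Im y + complex.Im x * complex.Re y.
Proof. by case: x; case: y. Qed.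

Lemma cdiff_cst (a : R[i]) p : cdiff_at (fun=> a) p.
Proof. by split; exact: diff_at_cst. Qed.

Lemma dcplx_cst (a : R[i]) (p : M) (v : tangent p) : dcplx (fun=> a) v = 0.
Proof. by rewrite /dcplx !dfun_cst. Qed.

Lemma cdiffD f h p : cdiff_at f p -> cdiff_at h p ->
  cdiff_at (fun q => f q + h q) p.
Proof.
move=> [f1 f2] [h1 h2]; rewrite /cdiff_at.
under eq_fun do rewrite raddfD /=.
split; first exact: diff_atD.
by under eq_fun do rewrite raddfD /=; exact: diff_atD.
Qed.

Lemma dcplxD f h p (v : tangent p) : cdiff_at f p -> cdiff_at h p ->
  dcplx (fun q => f q + h q) v = dcplx f v + dcplx h v.
Proof.
move=> [f1 f2] [h1 h2]; rewrite /dcplx.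
have -> : (fun q => complex.Re (f q + h q)) =
  (fun q => complex.Re (f q) + complex.Re (h q)) by apply/funext => q; rewrite raddfD.
have -> : (fun q => complex.Im (f q + h q)) =
  (fun q => complex.Im (f q) + complex.Im (h q)) by apply/funext => q; rewrite raddfD.
by rewrite !dfunD.
Qed.

Lemma cdiffM f h p : cdiff_at f p -> cdiff_at h p ->
  cdiff_at (fun q => f q * h q) p.
Proof.
move=> [f1 f2] [h1 h2]; split.
  have -> : (fun q => complex.Re (f q * h q)) = (fun q =>
    complex.Re (f q) * complex.Re (h q) + - (complex.Im (f q) * complex.Im (h q))).
    by apply/funext => q; rewrite ReM.
  by apply: diff_atD; [exact: diff_atM|apply: diff_atN; exact: diff_atM].
have -> : (fun q => complex.Im (f q * h q)) = (fun q =>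
  complex.Re (f q) * complex.Im (h q) + complex.Im (f q) * complex.Re (h q)).
  by apply/funext => q; rewrite ImM.
by apply: diff_atD; exact: diff_atM.
Qed.

Lemma dcplxM f h p (v : tangent p) : cdiff_at f p -> cdiff_at h p ->
  dcplx (fun q => f q * h q) v = dcplx f v * h p + f p * dcplx h v.
Proof.
move=> [f1 f2] [h1 h2]; rewrite /dcplx.
have -> : (fun q => complex.Re (f q * h q)) = (fun q =>
  complex.Re (f q) * complex.Re (h q) + - (complex.Im (f q) * complex.Im (h q))).
  by apply/funext => q; rewrite ReM.
have -> : (fun q => complex.Im (f q * h q)) = (fun q =>
  complex.Re (f q) * complex.Im (h q) + complex.Im (f q) * complex.Re (h q)).
  by apply/funext => q; rewrite ImM.
rewrite !dfunD ?dfunN ?dfunM; try (by do ?[apply: diff_atN]; do ?[apply: diff_atM]).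
move: (dfun _ v) (dfun _ v) (dfun _ v) (dfun _ v) => r s t u.
case: (f p) (h p) => a b [c d].
by apply/eqP; rewrite eq_complex /=; apply/andP; split; apply/eqP; ring.
Qed.

Lemma cdiffN f p : cdiff_at f p -> cdiff_at (fun q => - f q) p.
Proof.
have -> : (fun q => - f q) = (fun q => -1 * f q).
  by apply/funext => q; rewrite mulN1r.
by move=> df; apply: cdiffM => //; exact: cdiff_cst.
Qed.

Lemma dcplxN f p (v : tangent p) : cdiff_at f p ->
  dcplx (fun q => - f q) v = - dcplx f v.
Proof.
have -> : (fun q => - f q) = (fun q => -1 * f q).
  by apply/funext => q; rewrite mulN1r.
move=> df; rewrite dcplxM // ?dcplx_cst ?mul0r ?add0r ?mulN1r //.
exact: cdiff_cst.
Qed.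

Lemma cdiffB f h p : cdiff_at f p -> cdiff_at h p ->
  cdiff_at (fun q => f q - h q) p.
Proof. by move=> df dh; apply: cdiffD => //; exact: cdiffN. Qed.

Lemma dcplxB f h p (v : tangent p) : cdiff_at f p -> cdiff_at h p ->
  dcplx (fun q => f q - h q) v = dcplx f v - dcplx h v.
Proof. by move=> df dh; rewrite dcplxD ?dcplxN //; exact: cdiffN. Qed.

Lemma cdiff_conj f p : cdiff_at f p -> cdiff_at (fun q => conjc (f q)) p.
Proof.
move=> [f1 f2]; split.
  have -> // : (fun q => complex.Re (conjc (f q))) = (fun q => complex.Re (f q)).
  by apply/funext => q; case: (f q).
have -> : (fun q => complex.Im (conjc (f q))) = (fun q => - complex.Im (f q)).
  by apply/funext => q; case: (f q).
exact: diff_atN.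
Qed.

Lemma dcplx_conj f p (v : tangent p) : cdiff_at f p ->
  dcplx (fun q => conjc (f q)) v = conjc (dcplx f v).
Proof.
move=> [f1 f2]; rewrite /dcplx.
have -> : (fun q => complex.Re (conjc (f q))) = (fun q => complex.Re (f q)).
  by apply/funext => q; case: (f q).
have -> : (fun q => complex.Im (conjc (f q))) = (fun q => - complex.Im (f q)).
  by apply/funext => q; case: (f q).
by rewrite dfunN.
Qed.

Lemma zero_dcplx_cst f : path_connected (R := R) M ->
  (forall p, cdiff_at f p /\ forall v : tangent p, dcplx f v = 0) ->
  forall x y, f x = f y.
Proof.
move=> Mc f0 x y; apply/eqP; rewrite eq_complex; apply/andP; split; apply/eqP.
  apply: (zero_dfun_cst (f := fun q => complex.Re (f q))) => // q.
  by have [[f1 _] f2] := f0 q; split => // v; have [] := f2 v.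
apply: (zero_dfun_cst (f := fun q => complex.Im (f q))) => // q.
by have [[_ f1] f2] := f0 q; split => // v; have [] := f2 v.
Qed.

End ComplexCalculus.

#[local] Opaque cdiff_at dcplx.

Section QuaternionCalculus.
Context {R : realType} {M : surface R}.
Implicit Types f h : M -> HC R.

Definition hdiff_at f (p : M) : Prop := forall k, cdiff_at (fun q => f q 0 k) p.

Lemma dhcE f (p : M) (v : tangent p) k :
  dhc f v 0 k = dcplx (fun q => f q 0 k) v.
Proof. by rewrite mxE. Qed.

#[local] Opaque dhc.

Lemma smooth_hc_diff U f p : smooth_hc U f -> U p -> hdiff_at f p.
Proof.
move=> sf Up k; have [re im] := sf k.
by split; [exact: smooth_fun_diff re Up|exact: smooth_fun_diff im Up].
Qed.

Lemma dhc_linear f (p : M) a (v w : tangent p) :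
  dhc f (a *: v + w) = a%:C *: dhc f v + dhc f w.
Proof.
apply/rowP => k; rewrite !mxE !dfun_linear.
move: (dfun _ v) (dfun _ v) (dfun _ w) (dfun _ w) => r s t u.
by apply/eqP; rewrite eq_complex /= !mul0r ?addr0 ?subr0 !eqxx.
Qed.

Lemma dhcZ f (p : M) a (v : tangent p) : dhc f (a *: v) = a%:C *: dhc f v.
Proof.
have d0 : dhc f (0 : tangent p) = 0.
  have := dhc_linear f 1 (0 : tangent p) 0; rewrite scaler0 addr0 scale1r => /eqP.
  by rewrite -subr_eq subrr => /eqP ->.
by rewrite -[a *: v]addr0 dhc_linear d0 addr0.
Qed.

Lemma hdiff_cst (a : HC R) p : hdiff_at (fun=> a) p.
Proof. by move=> k; exact: cdiff_cst. Qed.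

Lemma dhc_cst (a : HC R) (p : M) (v : tangent p) : dhc (fun=> a) v = 0.
Proof. by apply/rowP => k; rewrite dhcE dcplx_cst mxE. Qed.

Lemma hdiffD f h p : hdiff_at f p -> hdiff_at h p ->
  hdiff_at (fun q => f q + h q) p.
Proof.
move=> df dh k; have -> : (fun q => (f q + h q) 0 k) =
  (fun q => f q 0 k + h q 0 k) by apply/funext => q; rewrite mxE.
exact: cdiffD (df k) (dh k).
Qed.

Lemma dhcD f h p (v : tangent p) : hdiff_at f p -> hdiff_at h p ->
  dhc (fun q => f q + h q) v = dhc f v + dhc h v.
Proof.
move=> df dh; apply/rowP => k; rewrite [RHS]mxE !dhcE.
rewrite -(dcplxD _ (df k) (dh k)); congr (dcplx _ v).
by apply/funext => q; rewrite mxE.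
Qed.

Let quatF (a b c d : M -> R[i]) :
  ((fun q => quat (a q) (b q) (c q) (d q) 0 0) = a) *
  ((fun q => quat (a q) (b q) (c q) (d q) 0 1) = b) *
  ((fun q => quat (a q) (b q) (c q) (d q) 0 2) = c) *
  ((fun q => quat (a q) (b q) (c q) (d q) 0 3) = d).
Proof. by do !split; apply/funext => q; rewrite quatE. Qed.

Lemma hdiff_quat (a b c d : M -> R[i]) p :
  cdiff_at a p -> cdiff_at b p -> cdiff_at c p -> cdiff_at d p ->
  hdiff_at (fun q => quat (a q) (b q) (c q) (d q)) p.
Proof. by move=> da db dc dd; apply: forall_ord4; rewrite quatF. Qed.

Lemma dhc_quat (a b c d : M -> R[i]) p (v : tangent p) :
  dhc (fun q => quat (a q) (b q) (c q) (d q)) v =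
  quat (dcplx a v) (dcplx b v) (dcplx c v) (dcplx d v).
Proof. by apply: rV4P; rewrite dhcE quatF quatE. Qed.

Let has (a : M -> R[i]) (p : M) (v : tangent p) (d : R[i]) : Prop :=
  cdiff_at a p /\ dcplx a v = d.

Let hasD a b (p : M) (v : tangent p) d e : has a v d -> has b v e ->
  has (fun q => a q + b q) v (d + e).
Proof. by move=> [? <-] [? <-]; split; [exact: cdiffD|exact: dcplxD]. Qed.

Let hasB a b (p : M) (v : tangent p) d e : has a v d -> has b v e ->
  has (fun q => a q - b q) v (d - e).
Proof. by move=> [? <-] [? <-]; split; [exact: cdiffB|exact: dcplxB]. Qed.

Let hasM f h (p : M) (v : tangent p) i j : hdiff_at f p -> hdiff_at h p ->
  has (fun q => f q 0 i * h q 0 j) v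
      (dhc f v 0 i * h p 0 j + f p 0 i * dhc h v 0 j).
Proof.
by move=> df dh; split; [exact: cdiffM|rewrite !dhcE; exact: dcplxM].
Qed.

(** Each component of the product is a signed sum of four products; the proof terms
    [c0], ..., [c3] follow the formulas which define the quaternion product. *)
Lemma dhc_hmul f h p : hdiff_at f p -> hdiff_at h p ->
  hdiff_at (fun q => hmul (f q) (h q)) p /\
  forall v : tangent p, dhc (fun q => hmul (f q) (h q)) v =
    hmul (dhc f v) (h p) + hmul (f p) (dhc h v).
Proof.
move=> df dh.
pose P i j v := hasM v i j df dh.
pose c0 v := hasB (hasB (hasB (P 0 0 v) (P 1 1 v)) (P 2 2 v)) (P 3 3 v).
pose c1 v := hasB (hasD (hasD (P 0 1 v) (P 1 0 v)) (P 2 3 v)) (P 3 2 v).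
pose c2 v := hasD (hasD (hasB (P 0 2 v) (P 1 3 v)) (P 2 0 v)) (P 3 1 v).
pose c3 v := hasD (hasB (hasD (P 0 3 v) (P 1 2 v)) (P 2 1 v)) (P 3 0 v).
split; first by apply: hdiff_quat;
  [exact: (c0 0).1|exact: (c1 0).1|exact: (c2 0).1|exact: (c3 0).1].
move=> v; rewrite dhc_quat (c0 v).2 (c1 v).2 (c2 v).2 (c3 v).2.
move: (dhc f v) (dhc h v) (f p) (h p) => a b c d.
by rewrite /hmul addq; apply: eq_quat; ring.
Qed.

Lemma hdiff_bar f p : hdiff_at f p -> hdiff_at (fun q => hbar (f q)) p.
Proof.
by move=> df; apply: hdiff_quat;
  [exact: df|exact: cdiffN (df 1)|exact: cdiffN (df 2)|exact: cdiffN (df 3)].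
Qed.

Lemma dhc_bar f p (v : tangent p) : hdiff_at f p ->
  dhc (fun q => hbar (f q)) v = hbar (dhc f v).
Proof.
move=> df; rewrite dhc_quat /hbar !dhcE.
by rewrite (dcplxN _ (df 1)) (dcplxN _ (df 2)) (dcplxN _ (df 3)).
Qed.

Lemma hdiff_hat f p : hdiff_at f p -> hdiff_at (fun q => hhat (f q)) p.
Proof.
move=> df k; have -> : (fun q => hhat (f q) 0 k) = (fun q => conjc (f q 0 k)).
  by apply/funext => q; rewrite mxE.
exact: cdiff_conj (df k).
Qed.

Lemma dhc_hat f p (v : tangent p) : hdiff_at f p ->
  dhc (fun q => hhat (f q)) v = hhat (dhc f v).
Proof.
move=> df; apply/rowP => k; rewrite dhcE [RHS]mxE dhcE.
rewrite -(dcplx_conj _ (df k)); congr (dcplx _ v).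
by apply/funext => q; rewrite mxE.
Qed.

Lemma dcplx_form f h p : hdiff_at f p -> hdiff_at h p ->
  cdiff_at (fun q => hform (f q) (h q)) p /\
  forall v : tangent p, dcplx (fun q => hform (f q) (h q)) v =
    hform (dhc f v) (h p) + hform (f p) (dhc h v).
Proof.
move=> df dh; have -> : (fun q => hform (f q) (h q)) = (fun q =>
  f q 0 0 * h q 0 0 + f q 0 1 * h q 0 1 + f q 0 2 * h q 0 2 + f q 0 3 * h q 0 3).
  by apply/funext => q; rewrite hformE.
pose P i v := hasM v i i df dh.
pose c v := hasD (hasD (hasD (P 0 v) (P 1 v)) (P 2 v)) (P 3 v).
split; first exact: (c 0).1.
move=> v; rewrite (c v).2 !hformE.
by move: (dhc f v) (dhc h v) (f p) (h p) => a b c' d; ring.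
Qed.

Lemma zero_dhc_cst f : path_connected (R := R) M ->
  (forall p, hdiff_at f p /\ forall v : tangent p, dhc f v = 0) ->
  forall x y, f x = f y.
Proof.
move=> Mc f0 x y; apply/rowP => k.
apply: (zero_dcplx_cst (f := fun q => f q 0 k)); [exact: Mc|move=> p].
have [df f0p] := f0 p; split; first exact: df.
by move=> v; rewrite -dhcE f0p mxE.
Qed.

End QuaternionCalculus.

#[local] Transparent diff_at dfun cdiff_at dcplx dhc.

(** * Orthonormal frames and the spin action on coordinates *)

(** An orthonormal pair in a plane is a basis, and the coefficients are read off with
    the metric.  It is stated for both signatures, [eps] being the square of [f0]. *)
Lemma orthonormal_decomp (R : realType) (V : lmodType R) (b : V -> V -> R)
    (a1 a2 f0 f1 : V) (eps : R) :
  (forall u v, b u v = b v u) ->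
  (forall a u v w, b (a *: u + v) w = a * b u w + b v w) ->
  (forall v, exists x : R * R, v = x.1 *: a1 + x.2 *: a2) ->
  eps * eps = 1 -> b f0 f0 = eps -> b f1 f1 = 1 -> b f0 f1 = 0 ->
  forall v, v = (eps * b v f0) *: f0 + b v f1 *: f1.
Proof.
move=> bC bL span eps1 b00 b11 b01.
have bD u v w : b (u + v) w = b u w + b v w by have := bL 1 u v w; rewrite scale1r mul1r.
have b0 w : b 0 w = 0.
  by have := bD 0 0 w; rewrite addr0 => /eqP; rewrite -subr_eq subrr => /eqP ->.
have bZ a u w : b (a *: u) w = a * b u w.
  by rewrite -[a *: u]addr0 bL b0 addr0.
have [[x0 y0] /= f0E] := span f0; have [[x1 y1] /= f1E] := span f1.
set d := x0 * y1 - x1 * y0.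
have da1 : d *: a1 = y1 *: f0 + (- y0) *: f1.
  rewrite f0E f1E !scalerDr !scalerA addrACA -!scalerDl.
  by rewrite [X in _ + X *: _](_ : _ = 0) ?scale0r ?addr0 /d; [congr (_ *: _)|]; ring.
have da2 : d *: a2 = (- x1) *: f0 + x0 *: f1.
  rewrite f0E f1E !scalerDr !scalerA addrACA -!scalerDl.
  by rewrite [X in X *: _ + _](_ : _ = 0) ?scale0r ?add0r /d; [congr (_ *: _)|]; ring.
have d0 : d != 0.
  apply/eqP => d0; move: da1 da2; rewrite d0 !scale0r => da1 da2.
  have eps0 : eps != 0 by apply/eqP => e0; move: eps1; rewrite e0 mul0r => /eqP; rewrite eq_sym oner_eq0.
  have y10 : y1 = 0.
    have := congr1 (b^~ f0) da1; rewrite b0 bD !bZ b00 (bC f1) b01 mulr0 addr0.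
    by move=> /esym/eqP; rewrite mulf_eq0 (negbTE eps0) orbF => /eqP.
  have x10 : x1 = 0.
    have := congr1 (b^~ f0) da2; rewrite b0 bD !bZ b00 (bC f1) b01 mulr0 addr0.
    by move=> /esym/eqP; rewrite mulf_eq0 (negbTE eps0) orbF oppr_eq0 => /eqP.
  move: b11; rewrite f1E x10 y10 !scale0r addr0 b0 => /eqP.
  by rewrite eq_sym oner_eq0.
have spanf v : exists x y, v = x *: f0 + y *: f1.
  have [[x y] /= vE] := span v.
  exists (d^-1 * (x * y1 - y * x1)), (d^-1 * (y * x0 - x * y0)).
  apply: (@scalerI _ _ d d0); rewrite vE scalerDr scalerA (mulrC d) -scalerA da1.
  rewrite scalerA (mulrC d) -scalerA da2 !scalerDr !scalerA addrACA -!scalerDl.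
  by rewrite !mulrA divff // !mul1r; congr (_ *: _ + _ *: _); ring.
move=> v; have [x [y vE]] := spanf v.
have -> : b v f0 = x * eps by rewrite vE bD !bZ b00 (bC f1) b01 mulr0 addr0.
have -> : b v f1 = y by rewrite vE bD !bZ b11 b01 mulr0 add0r mulr1.
by rewrite mulrCA eps1 mulr1.
Qed.

Section Bundle.
Context {R : realType} {M : surface R} {g : riemannian M} {E : lorentz_bundle M}.

Lemma emetricC (p : M) (u v : E p) : emetric u v = emetric v u.
Proof. by have [] := emetricP E. Qed.

Lemma emetric_linear (p : M) a (u v w : E p) :
  emetric (a *: u + v) w = a * emetric u w + emetric v w.
Proof. by have [] := emetricP E. Qed.

Lemma emetric0l (p : M) (w : E p) : emetric 0 w = 0.
Proof.
have := emetric_linear 1 0 0 w; rewrite scaler0 addr0 mul1r => /eqP.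
by rewrite -subr_eq subrr => /eqP ->.
Qed.

Lemma emetricDl (p : M) (u v w : E p) :
  emetric (u + v) w = emetric u w + emetric v w.
Proof. by have := emetric_linear 1 u v w; rewrite scale1r mul1r. Qed.

Lemma emetricZl (p : M) a (u w : E p) : emetric (a *: u) w = a * emetric u w.
Proof. by rewrite -[a *: u]addr0 emetric_linear emetric0l addr0. Qed.

Lemma rmetricC (p : M) (u v : tangent p) : rmetric g u v = rmetric g v u.
Proof. by have [] := rmetricP g. Qed.

Lemma rmetric_linear (p : M) a (u v w : tangent p) :
  rmetric g (a *: u + v) w = a * rmetric g u w + rmetric g v w.
Proof. by have [] := rmetricP g. Qed.

Lemma rmetric0l (p : M) (w : tangent p) : rmetric g 0 w = 0.
Proof.
have := rmetric_linear 1 0 0 w; rewrite scaler0 addr0 mul1r => /eqP.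
by rewrite -subr_eq subrr => /eqP ->.
Qed.

Lemma rmetricDl (p : M) (u v w : tangent p) :
  rmetric g (u + v) w = rmetric g u w + rmetric g v w.
Proof. by have := rmetric_linear 1 u v w; rewrite scale1r mul1r. Qed.

Lemma rmetricZl (p : M) a (u w : tangent p) :
  rmetric g (a *: u) w = a * rmetric g u w.
Proof. by rewrite -[a *: u]addr0 rmetric_linear rmetric0l addr0. Qed.

Lemma Q1_decomp (p : M) (e : E p * E p) : Q1 e ->
  forall v, v = (- emetric v e.1) *: e.1 + emetric v e.2 *: e.2.
Proof.
move=> [e00 e11 e01 _ _] v.
have [_ /(_ p)[U [a [b [_ Up [span _]]]]]] := fibreP E.
rewrite -mulN1r; apply: (orthonormal_decomp (a1 := a p) (a2 := b p)) => //.
- exact: emetricC.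
- exact: emetric_linear.
- by move=> w; have [x [wE _]] := span p Up w; exists x.
- by rewrite mulrNN mulr1.
Qed.

Lemma Q2_decomp (p : M) (e : tangent p * tangent p) : Q2 g e ->
  forall v, v = rmetric g v e.1 *: e.1 + rmetric g v e.2 *: e.2.
Proof.
move=> [e00 e11 e01 _] v; rewrite -[X in X *: e.1]mul1r.
apply: (orthonormal_decomp (V := tangent p) (a1 := delta_mx 0 0 : 'rV[R]_2)
  (a2 := delta_mx 0 1 : 'rV[R]_2)) => //.
- exact: rmetricC.
- exact: rmetric_linear.
- move=> w; exists (w 0 0, w 0 1) => /=.
  rewrite [LHS]row_sum_delta big_ord_recl big_ord1.
  by congr (w 0 _ *: delta_mx 0 _ + w 0 _ *: delta_mx 0 _); exact/val_inj.
- by rewrite mulr1.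
Qed.

End Bundle.

Ltac complex_ring :=
  apply/eqP; rewrite eq_complex; apply/andP; split; apply/eqP; rewrite /=; ring.

Section SpinAlgebra.
Context {R : realType}.
Implicit Types c s k l x y t : R.

Lemma cosh2_sinh2 t : cosh t ^+ 2 - sinh t ^+ 2 = 1.
Proof.
have : expR t * expR (- t) = 1 by rewrite -expRD subrr expR0.
by rewrite /cosh /sinh; move: (expR t) (expR (- t)) => a b ab; field: ab.
Qed.

Lemma hinv_unit (q : HC R) : hform q q = 1 -> hinv q = hbar q.
Proof. by move=> q1; rewrite /hinv q1 invr1 scale1r. Qed.

Lemma hbar_unit (q : HC R) : hform q q = 1 -> hmul (hbar q) q = hone.
Proof. by move=> q1; rewrite hbarq q1 scale1r. Qed.

Lemma hunit_bar (q : HC R) : hform q q = 1 -> hmul q (hbar q) = hone.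
Proof. by move=> q1; rewrite hqbar q1 scale1r. Qed.

Lemma hhat1 : hhat (@hone R) = hone.
Proof. by rewrite hhat_quat !conjc0 conjc1. Qed.

(** Elements of Spin(1,1) and Spin(2), with [c] for [cosh t], [s] for [sinh t], [k] for
    [cos t] and [l] for [sin t], so that the action on vectors becomes a polynomial
    identity modulo [c^2 - s^2 = 1] and [k^2 + l^2 = 1]. *)
Definition boost c s : HC R := quat c%:C (0 +i* s) 0 0.
Definition turn k l : HC R := quat k%:C l%:C 0 0.

Lemma boost_form c s : hform (boost c s) (boost c s) = (c ^+ 2 - s ^+ 2)%:C.
Proof. by rewrite hformE !quatE; complex_ring. Qed.

Lemma turn_form k l : hform (turn k l) (turn k l) = (k ^+ 2 + l ^+ 2)%:C.
Proof. by rewrite hformE !quatE; complex_ring. Qed.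

Lemma boost_act c s x y : c ^+ 2 - s ^+ 2 = 1 ->
  mink ((c ^+ 2 + s ^+ 2) * x - 2 * c * s * y)
       ((c ^+ 2 + s ^+ 2) * y - 2 * c * s * x) 0 0 =
  hmul (hmul (boost c s) (mink x y 0 0)) (hinv (hhat (boost c s))).
Proof.
move=> cs; rewrite hinv_unit ?hform_hat ?boost_form ?cs ?conjc1 //.
rewrite /boost /mink hhat_quat hbar_quat !hmul_quat.
by apply: eq_quat; complex_ring.
Qed.

Lemma turn_act k l x y : k ^+ 2 + l ^+ 2 = 1 ->
  mink 0 0 ((k ^+ 2 - l ^+ 2) * x - 2 * k * l * y)
           ((k ^+ 2 - l ^+ 2) * y + 2 * k * l * x) =
  hmul (hmul (turn k l) (mink 0 0 x y)) (hinv (hhat (turn k l))).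
Proof.
move=> kl; rewrite hinv_unit ?hform_hat ?turn_form ?kl ?conjc1 //.
rewrite /turn /mink hhat_quat hbar_quat !hmul_quat.
by apply: eq_quat; complex_ring.
Qed.

(** Each factor acts on its own plane by its square and on the other plane by its norm. *)
Lemma boost_turn_act c s k l x0 x1 x2 x3 :
  c ^+ 2 - s ^+ 2 = 1 -> k ^+ 2 + l ^+ 2 = 1 ->
  mink ((c ^+ 2 + s ^+ 2) * x0 + 2 * c * s * x1)
       ((c ^+ 2 + s ^+ 2) * x1 + 2 * c * s * x0)
       ((k ^+ 2 - l ^+ 2) * x2 + 2 * k * l * x3)
       ((k ^+ 2 - l ^+ 2) * x3 - 2 * k * l * x2) =
  hmul (hmul (hbar (hmul (boost c s) (turn k l))) (mink x0 x1 x2 x3))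
       (hhat (hmul (boost c s) (turn k l))).
Proof.
(* The norms of the two factors make the identity polynomial. *)
move=> cs kl; transitivity (mink
  ((k ^+ 2 + l ^+ 2) * ((c ^+ 2 + s ^+ 2) * x0 + 2 * c * s * x1))
  ((k ^+ 2 + l ^+ 2) * ((c ^+ 2 + s ^+ 2) * x1 + 2 * c * s * x0))
  ((c ^+ 2 - s ^+ 2) * ((k ^+ 2 - l ^+ 2) * x2 + 2 * k * l * x3))
  ((c ^+ 2 - s ^+ 2) * ((k ^+ 2 - l ^+ 2) * x3 - 2 * k * l * x2))).
  by rewrite cs kl !mul1r.
rewrite hbarM hhatM /boost /turn /mink !hhat_quat !hbar_quat !hmul_quat.
by apply: eq_quat; complex_ring.
Qed.

Lemma mink_form x0 x1 x2 x3 y0 y1 y2 y3 :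
  hform (mink x0 x1 x2 x3) (mink y0 y1 y2 y3) =
  (- (x0 * y0) + x1 * y1 + x2 * y2 + x3 * y3)%:C.
Proof. by rewrite hformE !quatE; complex_ring. Qed.

Lemma mink_linear (a : R) x0 x1 x2 x3 y0 y1 y2 y3 :
  mink (a * x0 + y0) (a * x1 + y1) (a * x2 + y2) (a * x3 + y3) =
  a%:C *: mink x0 x1 x2 x3 + mink y0 y1 y2 y3.
Proof. by rewrite scaleq addq; apply: eq_quat; complex_ring. Qed.

Lemma mink_R13 x0 x1 x2 x3 : R13 (mink x0 x1 x2 x3).
Proof.
by rewrite /R13 /= /mink hbar_quat hhat_quat oppq; apply: eq_quat; complex_ring.
Qed.

Lemma R13_mink (xi : HC R) : R13 xi -> exists x0 x1 x2 x3, xi = mink x0 x1 x2 x3.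
Proof.
rewrite (quat_eta xi).
case: (xi 0 0) (xi 0 1) (xi 0 2) (xi 0 3) => a0 b0 [a1 b1] [a2 b2] [a3 b3].
rewrite /R13 /= hbar_quat hhat_quat oppq => /rowP xiE.
have := xiE 0; have := xiE 1; have := xiE 2; have := xiE 3; rewrite !quatE.
move=> [_ h3] [_ h2] [_ h1] [h0 _].
have z (b : R) : b = - - - b -> b = 0.
  by move=> /eqP; rewrite opprK -subr_eq0 opprK -mulr2n mulrn_eq0 /= => /eqP.
exists b0, a1, a2, a3; rewrite /mink.
rewrite (z _ h1) (z _ h2) (z _ h3); congr quat; congr (_ +i* _).
by move/eqP: h0; rewrite -subr_eq0 opprK -mulr2n mulrn_eq0 /= => /eqP.
Qed.

Lemma R13D (xi zeta : HC R) : R13 xi -> R13 zeta -> R13 (xi + zeta).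
Proof.
move=> /R13_mink[x0 [x1 [x2 [x3 ->]]]] /R13_mink[y0 [y1 [y2 [y3 ->]]]].
rewrite -[mink x0 x1 x2 x3]scale1r -(mink_linear 1); exact: mink_R13.
Qed.

Lemma R13N (xi : HC R) : R13 xi -> R13 (- xi).
Proof.
move=> /R13_mink[x0 [x1 [x2 [x3 ->]]]].
rewrite (_ : - _ = mink (- x0) (- x1) (- x2) (- x3)); first exact: mink_R13.
by rewrite oppq; apply: eq_quat; complex_ring.
Qed.

Lemma R13_act (q xi : HC R) : R13 xi -> R13 (hmul (hbar q) (hmul xi (hhat q))).
Proof.
rewrite /R13 /= => xiE.
rewrite !hbarM !hhatM !hhat_bar hhatK hbarK -hmulA -hhat_bar -hmulNr -hmulNl.
by rewrite -xiE.
Qed.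

Lemma act_form (q xi zeta : HC R) : hform q q = 1 ->
  hform (hmul (hbar q) (hmul xi (hhat q))) (hmul (hbar q) (hmul zeta (hhat q))) =
  hform xi zeta.
Proof.
by move=> q1; rewrite hformMl hform_bar hformMr hform_hat q1 conjc1 mul1r mulr1.
Qed.

Lemma act_inv (q xi : HC R) : hform q q = 1 ->
  hmul (hbar q) (hmul (hmul q (hmul xi (hhat (hbar q)))) (hhat q)) = xi.
Proof.
move=> q1; rewrite !hmulA hbar_unit // hmul1q -!hmulA.
by rewrite -hhatM hbar_unit // hhat1 hmulq1.
Qed.

(** The reversed Cauchy-Schwarz inequality for timelike vectors. *)
Lemma future_form (x0 x1 x2 x3 y0 y1 y2 y3 : R) :
  0 < x0 -> x1 ^+ 2 + x2 ^+ 2 + x3 ^+ 2 < x0 ^+ 2 ->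
  0 < y0 -> y1 ^+ 2 + y2 ^+ 2 + y3 ^+ 2 < y0 ^+ 2 ->
  - (x0 * y0) + x1 * y1 + x2 * y2 + x3 * y3 < 0.
Proof.
move=> x00 xx y00 yy.
set s := x1 * y1 + x2 * y2 + x3 * y3.
have ss : s ^+ 2 <= (x1 ^+ 2 + x2 ^+ 2 + x3 ^+ 2) * (y1 ^+ 2 + y2 ^+ 2 + y3 ^+ 2).
  rewrite -subr_ge0 (_ : _ - _ = (x1 * y2 - x2 * y1) ^+ 2 +
    (x1 * y3 - x3 * y1) ^+ 2 + (x2 * y3 - x3 * y2) ^+ 2).
    by rewrite !addr_ge0 // sqr_ge0.
  by rewrite /s; ring.
have s2 : s ^+ 2 < (x0 * y0) ^+ 2.
  apply: le_lt_trans ss _; rewrite exprMn.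
  by apply: ltr_pM; rewrite ?addr_ge0 ?sqr_ge0.
have : s < x0 * y0.
  have [s0|s0] := ltP s 0; first by apply: lt_trans s0 _; exact: mulr_gt0.
  by move: s2; rewrite ltr_pXn2r // nnegrE ltW // mulr_gt0.
by rewrite /s; lra.
Qed.

End SpinAlgebra.

(** * Vectors defined by a unit spinor *)

Section Frames.
Context {R : realType} {M : surface R} {g : riemannian M} {E : lorentz_bundle M}.
Context {S1 : spin_structure_E E} {S2 : spin_structure_M g}.

Lemma Spin11P (h : HC R) : Spin11 h ->
  exists c s, c ^+ 2 - s ^+ 2 = 1 /\ (h = boost c s \/ h = - boost c s).
Proof. by case=> t hE; exists (cosh t), (sinh t); split; [exact: cosh2_sinh2|]. Qed.

Lemma Spin2P (h : HC R) : Spin2 h ->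
  exists k l, k ^+ 2 + l ^+ 2 = 1 /\ h = turn k l.
Proof. by case=> t ->; exists (cos t), (sin t); split; [exact: cos2Dsin2|]. Qed.

Lemma spin_unit (g1 g2 : HC R) : Spin11 g1 -> Spin2 g2 ->
  hform (hmul g1 g2) (hmul g1 g2) = 1.
Proof.
move=> /Spin11P[c [s [cs h1]]] /Spin2P[k [l [kl ->]]].
rewrite hformMl turn_form kl mulr1.
by case: h1 => ->; rewrite ?hformNl ?hformNr ?opprK boost_form cs.
Qed.

Lemma spin_frame_boost (p : M) (s1 : S1 p) (h : HC R) c s : Spin11 h ->
  c ^+ 2 - s ^+ 2 = 1 -> h = boost c s \/ h = - boost c s ->
  (spin_frame (spin_act s1 h)).1 = (c ^+ 2 + s ^+ 2) *: (spin_frame s1).1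
                                    + - (2 * c * s) *: (spin_frame s1).2 /\
  (spin_frame (spin_act s1 h)).2 = - (2 * c * s) *: (spin_frame s1).1
                                    + (c ^+ 2 + s ^+ 2) *: (spin_frame s1).2.
Proof.
move=> hS cs hE.
have act x y : mink ((c ^+ 2 + s ^+ 2) * x - 2 * c * s * y)
       ((c ^+ 2 + s ^+ 2) * y - 2 * c * s * x) 0 0 =
  hmul (hmul h (mink x y 0 0)) (hinv (hhat h)).
  rewrite (boost_act _ _ cs); case: hE => ->; first exact: erefl.
  rewrite hmulNl hhatN /hinv hformNl hformNr opprK hbarN scalerN hmulNr hmulNl.
  by rewrite opprK.
have := spin_frame_act s1 hS (act 1 0); have := spin_frame_act s1 hS (act 0 1).
by rewrite !mulr1 !mulr0 !subr0 !sub0r !scale1r !scale0r add0r addr0.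
Qed.

Lemma spin_frame_turn (p : M) (s2 : S2 p) k l : Spin2 (turn k l) ->
  k ^+ 2 + l ^+ 2 = 1 ->
  (spin_frame (spin_act s2 (turn k l))).1 =
    (k ^+ 2 - l ^+ 2) *: (spin_frame s2).1 + (2 * k * l) *: (spin_frame s2).2 /\
  (spin_frame (spin_act s2 (turn k l))).2 =
    - (2 * k * l) *: (spin_frame s2).1 + (k ^+ 2 - l ^+ 2) *: (spin_frame s2).2.
Proof.
move=> hS kl.
have := spin_frame_act s2 hS (turn_act 1 0 kl).
have := spin_frame_act s2 hS (turn_act 0 1 kl).
rewrite !mulr1 !mulr0 !subr0 !sub0r !addr0 !add0r.
by rewrite !scale1r !scale0r add0r addr0.
Qed.

(** The coordinates of a vector transform under the spin group as the vectors of
    the Minkowski space. *)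
Lemma vcoord_act (p : M) (X : E p * tangent p) (s1 : S1 p) (s2 : S2 p)
    (g1 g2 : HC R) : Spin11 g1 -> Spin2 g2 ->
  vcoord X (spin_act s1 g1) (spin_act s2 g2) =
  hmul (hmul (hbar (hmul g1 g2)) (vcoord X s1 s2)) (hhat (hmul g1 g2)).
Proof.
move=> h1 h2; have [c [s [cs g1E]]] := Spin11P h1.
have [k [l [kl g2E]]] := Spin2P h2.
have [f0 f1] := spin_frame_boost s1 h1 cs g1E.
subst g2; have [f2 f3] := spin_frame_turn s2 h2 kl.
transitivity (hmul (hmul (hbar (hmul (boost c s) (turn k l))) (vcoord X s1 s2))
    (hhat (hmul (boost c s) (turn k l)))); last first.
  case: g1E => ->; first exact: erefl.
  by rewrite !hmulNl hbarN hhatN !hmulNl hmulNr opprK.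
rewrite /vcoord -(boost_turn_act _ _ _ _ cs kl) f0 f1 f2 f3.
rewrite (emetricC X.1) emetricDl !emetricZl (emetricC _ X.1) (emetricC _ X.1).
rewrite (emetricC X.1 (_ + _)) emetricDl !emetricZl (emetricC _ X.1) (emetricC _ X.1).
rewrite (rmetricC X.2) rmetricDl !rmetricZl (rmetricC _ X.2) (rmetricC _ X.2).
rewrite (rmetricC X.2 (_ + _)) rmetricDl !rmetricZl (rmetricC _ X.2) (rmetricC _ X.2).
by congr mink; ring.
Qed.

Lemma spin_pt_act (p : M) (s1 : S1 p) (s2 : S2 p) : exists g1 g2,
  [/\ Spin11 g1, Spin2 g2, s1 = spin_act (spin_pt S1 p) g1
    & s2 = spin_act (spin_pt S2 p) g2].
Proof.
have [g1 [[h1 ->] _]] := spin_torsor (spin_pt S1 p) s1.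
have [g2 [[h2 ->] _]] := spin_torsor (spin_pt S2 p) s2.
by exists g1, g2.
Qed.

Lemma vcoord_linear (p : M) a (X Y : E p * tangent p) (s1 : S1 p) (s2 : S2 p) :
  vcoord (a *: X + Y) s1 s2 = a%:C *: vcoord X s1 s2 + vcoord Y s1 s2.
Proof.
rewrite /vcoord -mink_linear /= !emetric_linear !rmetric_linear.
by congr mink; ring.
Qed.

Lemma vcoord_form (p : M) (X Y : E p * tangent p) (s1 : S1 p) (s2 : S2 p) :
  hform (vcoord X s1 s2) (vcoord Y s1 s2) =
  (emetric X.1 Y.1 + rmetric g X.2 Y.2)%:C.
Proof.
rewrite /vcoord mink_form; congr (_%:C).
rewrite [in RHS](Q1_decomp (spin_frameP s1) X.1).
rewrite [in RHS](Q2_decomp (spin_frameP s2) X.2).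
rewrite emetricDl !emetricZl rmetricDl !rmetricZl.
rewrite !(emetricC _ Y.1) !(rmetricC _ Y.2); ring.
Qed.

Lemma vcoord_surj (p : M) (s1 : S1 p) (s2 : S2 p) (xi : HC R) : R13 xi ->
  exists X, xi = vcoord X s1 s2.
Proof.
move=> /R13_mink[x0 [x1 [x2 [x3 ->]]]].
have [e00 e11 e01 _ _] := spin_frameP s1.
have [e22 e33 e23 _] := spin_frameP s2.
exists (x0 *: (spin_frame s1).1 + x1 *: (spin_frame s1).2,
        x2 *: (spin_frame s2).1 + x3 *: (spin_frame s2).2).
rewrite /vcoord /= !emetricDl !emetricZl !rmetricDl !rmetricZl.
rewrite (emetricC (spin_frame s1).2) (rmetricC (spin_frame s2).2).
rewrite e00 e11 e01 e22 e33 e23; congr mink; ring.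
Qed.

End Frames.

(** The time coordinate of the image of [i1] is [sum_k |q_k|^2], which is bounded below
    by the real part of [H(q, q)]. *)
Lemma future_act (R : realType) (q : HC R) : hform q q = 1 ->
  0 < complex.Im (hmul q (hmul (mink 1 0 0 0) (hhat (hbar q))) 0 0).
Proof.
rewrite (quat_eta q).
case: (q 0 0) (q 0 1) (q 0 2) (q 0 3) => a0 b0 [a1 b1] [a2 b2] [a3 b3].
rewrite /mink hbar_quat hhat_quat !hmul_quat hformE !quatE => -[re _] /=.
apply: lt_le_trans ltr01 _; rewrite -[leLHS]re -subr_ge0.
rewrite [leRHS](_ : _ = 2 * (b0 ^+ 2 + b1 ^+ 2 + b2 ^+ 2 + b3 ^+ 2)); last by ring.
by rewrite mulr_ge0 ?addr_ge0 ?sqr_ge0.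
Qed.

Section SpinorVectors.
Context {R : realType} {M : surface R} {g : riemannian M} {E : lorentz_bundle M}.
Context {S1 : spin_structure_E E} {S2 : spin_structure_M g}.
Variable phi : forall p, Sigma S1 S2 p.
Arguments phi p : clear implicits.

(** The vector [<<X . phi, phi>>]: for [X] tangent it is [dF(X)], for [X] in [E] the
    corresponding vector of the normal bundle. *)
Definition spin_vec (p : M) (X : E p * tangent p) : HC R :=
  spinor_pairing (clifford X (phi p)) (phi p).

Hypothesis phiS : forall p, is_spinor_at (phi p).
Hypothesis phi1 : forall p, spinor_form (phi p) (phi p) = 1.

Lemma phi_act (p : M) (s1 : S1 p) (s2 : S2 p) (g1 g2 : HC R) :
  Spin11 g1 -> Spin2 g2 ->
  phi p (spin_act s1 g1) (spin_act s2 g2) = hmul (hbar (hmul g1 g2)) (phi p s1 s2).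
Proof. by move=> h1 h2; rewrite phiS // hinv_unit // spin_unit. Qed.

Lemma phi_unit (p : M) (s1 : S1 p) (s2 : S2 p) :
  hform (phi p s1 s2) (phi p s1 s2) = 1.
Proof.
have [g1 [g2 [h1 h2 -> ->]]] := spin_pt_act s1 s2.
by rewrite phi_act // hformMl hform_bar spin_unit // mul1r; exact: phi1.
Qed.

(** The spinor coordinate and the vector coordinates change by inverse elements, so that
    any pair of spin frames can be used. *)
Lemma spin_vecE (p : M) (X : E p * tangent p) (s1 : S1 p) (s2 : S2 p) :
  spin_vec X =
  hmul (hbar (phi p s1 s2)) (hmul (vcoord X s1 s2) (hhat (phi p s1 s2))).
Proof.
have [g1 [g2 [h1 h2 -> ->]]] := spin_pt_act s1 s2.
rewrite phi_act // vcoord_act // /spin_vec /spinor_pairing /clifford.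
have := spin_unit h1 h2; move: (hmul g1 g2) => h hu.
rewrite hbarM hbarK hhatM !hmulA.
rewrite -(hmulA _ h) hunit_bar // hmulq1 -[in RHS](hmulA _ (hhat h)).
by rewrite -hhatM hunit_bar // hhat1 hmulq1.
Qed.

Lemma spin_vec_linear (p : M) a (X Y : E p * tangent p) :
  spin_vec (a *: X + Y) = a%:C *: spin_vec X + spin_vec Y.
Proof.
pose s1 := spin_pt S1 p; pose s2 := spin_pt S2 p.
rewrite !(spin_vecE _ s1 s2) vcoord_linear hmulDl hmulZl hmulDr hmulZr.
by [].
Qed.

Lemma spin_vec0 (p : M) : spin_vec (0 : E p * tangent p) = 0.
Proof.
have := spin_vec_linear 1 (0 : E p * tangent p) 0.
rewrite scaler0 addr0 scale1r => /eqP.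
by rewrite -subr_eq subrr => /eqP ->.
Qed.

Lemma spin_vec_tangentD (p : M) a b (u v : tangent p) :
  spin_vec (0, a *: u + b *: v) = a%:C *: spin_vec (0, u) + b%:C *: spin_vec (0, v).
Proof.
have -> : (0, a *: u + b *: v) =
    a *: (0, u) + (b *: (0, v) + 0) :> E p * tangent p.
  by rewrite addr0; congr pair; rewrite /= !scaler0 addr0.
by rewrite !spin_vec_linear spin_vec0 addr0.
Qed.

Lemma spin_vec_normalD (p : M) a b (u v : E p) :
  spin_vec (a *: u + b *: v, 0) = a%:C *: spin_vec (u, 0) + b%:C *: spin_vec (v, 0).
Proof.
have -> : (a *: u + b *: v, 0) =
    a *: (u, 0) + (b *: (v, 0) + 0) :> E p * tangent p.
  by rewrite addr0; congr pair; rewrite /= !scaler0 addr0.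
by rewrite !spin_vec_linear spin_vec0 addr0.
Qed.

Lemma spin_vec_form (p : M) (X Y : E p * tangent p) :
  hform (spin_vec X) (spin_vec Y) = (emetric X.1 Y.1 + rmetric g X.2 Y.2)%:C.
Proof.
pose s1 := spin_pt S1 p; pose s2 := spin_pt S2 p.
by rewrite !(spin_vecE _ s1 s2) act_form ?vcoord_form //; exact: phi_unit.
Qed.

Lemma spin_vec_R13 (p : M) (X : E p * tangent p) : R13 (spin_vec X).
Proof.
by rewrite (spin_vecE _ (spin_pt S1 p) (spin_pt S2 p)); apply: R13_act; exact: mink_R13.
Qed.

Lemma spin_vec_surj (p : M) (xi : HC R) : R13 xi -> exists X, xi = spin_vec (p := p) X.
Proof.
pose s1 := spin_pt S1 p; pose s2 := spin_pt S2 p.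
move=> xiR; pose q := phi p s1 s2.
have [X XE] : exists X, hmul q (hmul xi (hhat (hbar q))) = vcoord X s1 s2.
  by apply: vcoord_surj; have := R13_act (hbar q) xiR; rewrite hbarK.
exists X; rewrite (spin_vecE _ s1 s2) -XE act_inv //; exact: phi_unit.
Qed.

(** [q] acts by an isometry which maps the unit future vector [i1] to a vector with
    time coordinate [|q|^2], so that it preserves the future cone. *)
Lemma spin_vec_future (p : M) (u : E p) : emetric u u = -1 -> future u ->
  0 < complex.Im (spin_vec (u, 0) 0 0).
Proof.
move=> uu uF; pose s1 := spin_pt S1 p; pose s2 := spin_pt S2 p.
have [e00 e11 e01 e0F _] := spin_frameP s1.
pose q := phi p s1 s2; have q1 : hform q q = 1 by exact: phi_unit.
pose m := hmul q (hmul (mink 1 0 0 0) (hhat (hbar q))).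
have mE : mink 1 0 0 0 = hmul (hbar q) (hmul m (hhat q)) by rewrite act_inv.
have m1 : hform m m = -1.
  rewrite -(act_form _ _ q1) -mE mink_form; congr (_ +i* _); ring.
have mR : R13 m.
  by have := R13_act (hbar q) (mink_R13 1 0 0 0); rewrite hbarK.
have m0 : 0 < complex.Im (m 0 0) by exact: future_act.
have uE : hform (spin_vec (u, 0)) (mink 1 0 0 0) = hform (vcoord (u, 0) s1 s2) m.
  by rewrite (spin_vecE _ s1 s2) {1}mE act_form.
have [x0 [x1 [x2 [x3 mX]]]] := R13_mink mR.
have : hform (spin_vec (u, 0)) (mink 1 0 0 0) =
    (- complex.Im (spin_vec (u, 0) 0 0))%:C.
  have [y0 [y1 [y2 [y3 ->]]]] := R13_mink (spin_vec_R13 (u, 0)).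
  by rewrite mink_form quatE /=; congr (_%:C); ring.
rewrite uE mX /vcoord mink_form /= => -[] uI.
rewrite -oppr_lt0 -uI; apply: future_form.
- have [_ _ /(_ p _ u e0F) + _] := futureP E; rewrite uu mulrNN mulr1 ltr01.
  by rewrite emetricC mulN1r => /(_ isT)[+ _]; apply.
- have := vcoord_form (u, 0) (u, 0) s1 s2; rewrite /vcoord mink_form /= uu.
  rewrite !rmetric0l addr0 => -[] uu1; rewrite -subr_gt0.
  by rewrite (_ : _ - _ = 1) ?ltr01 //; lra.
- by move: m0; rewrite mX quatE.
- move: m1; rewrite mX mink_form => -[] mm.
  by rewrite -subr_gt0 (_ : _ - _ = 1) ?ltr01 //; lra.
Qed.

End SpinorVectors.

(** * The differential of the vector defined by a parallel normal field *)

(** The Dirac equation for the endomorphisms [eta] with [nabla_X phi = eta(X) phi]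
    kills their component along [I] and leaves in the others the second
    fundamental form, whose trace is prescribed. *)
Lemma dirac_eta (R : realType) (eta2 eta3 : HC R) (h0 h1 : R) :
  eta2 0 0 = 0 -> eta3 0 0 = 0 ->
  hmul (mink 0 0 1 0) (hhat eta2) + hmul (mink 0 0 0 1) (hhat eta3) =
    mink h0 h1 0 0 ->
  forall x y, exists z22 z23 z32 z33,
  [/\ hmul (hbar eta2) (mink x y 0 0) + hmul (mink x y 0 0) (hhat eta2) =
        mink 0 0 z22 z23,
      hmul (hbar eta3) (mink x y 0 0) + hmul (mink x y 0 0) (hhat eta3) =
        mink 0 0 z32 z33
    & z22 + z33 = 2 * (x * h0 - y * h1)].
Proof.
rewrite (quat_eta eta2) (quat_eta eta3) !quatE => -> ->.
case: (eta2 0 1) (eta2 0 2) (eta2 0 3) => a1 a2 [b1 b2] [c1 c2].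
case: (eta3 0 1) (eta3 0 2) (eta3 0 3) => a1' a2' [b1' b2'] [c1' c2'].
rewrite /mink !hhat_quat !hmul_quat addq => /rowP H.
have := H 0; have := H 1; have := H 2; have := H 3; rewrite !quatE /=.
move=> [k1 k2] [j1 j2] [i1 i2] [l1 l2] x y.
exists (2 * x * b2 - 2 * y * c1), (2 * x * c2 + 2 * y * b1),
  (2 * x * b2' - 2 * y * c1'), (2 * x * c2' + 2 * y * b1'); split.
- rewrite hbar_quat !hmul_quat addq.
  have a10 : a1 = 0 by lra.
  have a20 : a2 = 0 by lra.
  by rewrite a10 a20; apply: eq_quat; complex_ring.
- rewrite hbar_quat !hmul_quat addq.
  have a10 : a1' = 0 by lra.
  have a20 : a2' = 0 by lra.
  by rewrite a10 a20; apply: eq_quat; complex_ring.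
- have -> : h0 = b2 + c2' by lra.
  have -> : h1 = c1 - b1' by lra.
  ring.
Qed.

Section ParallelField.
Context {R : realType} {M : surface R} {g : riemannian M} {E : lorentz_bundle M}.
Context {S1 : spin_structure_E E} {S2 : spin_structure_M g}.
Variables (phi : forall p, Sigma S1 S2 p) (Hvec : section E).
Arguments phi p : clear implicits.
Hypothesis phiS : is_spinor_field phi.
Hypothesis phi1 : forall p, spinor_form (phi p) (phi p) = 1.
Hypothesis phiD : dirac_equation Hvec phi.

Lemma local_spin_sections (p : M) : exists U (s1 : forall p, S1 p) (s2 : forall p, S2 p),
  [/\ open U, U p, spin_smooth U s1 & spin_smooth U s2].
Proof.
have [U1 [s1 [oU1 U1p sm1]]] := spin_smooth_ex S1 p.
have [U2 [s2 [oU2 U2p sm2]]] := spin_smooth_ex S2 p.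
exists (U1 `&` U2), s1, s2; split; [exact: openI|by []|..].
  have [loc _] := spin_smooth_local S1.
  by apply: (loc _ _ _ oU1 _ _ sm1); [exact: openI|exact: subIsetl].
have [loc _] := spin_smooth_local S2.
by apply: (loc _ _ _ oU2 _ _ sm2); [exact: openI|exact: subIsetr].
Qed.

Section Local.
Variables (U : set M) (p : M) (s1 : forall p, S1 p) (s2 : forall p, S2 p).
Hypotheses (oU : open U) (Up : U p) (sm1 : spin_smooth U s1) (sm2 : spin_smooth U s2).
Variable Y : section E.
Hypotheses (smY : smooth_sec setT Y) (parY : forall p (X : tangent p), econn X Y = 0).

Let f0 : section E := fun q => (spin_frame (s1 q)).1.
Let f1 : section E := fun q => (spin_frame (s1 q)).2.

Lemma smooth_sec_restrict (V : set M) (s : section E) :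
  open V -> smooth_sec setT s -> smooth_sec V s.
Proof.
move=> oV sms; have [[loc _] _] := fibreP E.
by apply: (loc _ _ _ openT oV _ sms).
Qed.

(** For [Y = y0 f0 + y1 f1] in the moving frame, being parallel means
    [d y0 = - w y1] and [d y1 = - w y0]. *)
Lemma vcoord_parallel :
  hdiff_at (fun q => vcoord (Y q, 0) (s1 q) (s2 q)) p /\
  forall X : tangent p, dhc (fun q => vcoord (Y q, 0) (s1 q) (s2 q)) X =
    let w := emetric (econn X f0) (f1 p) in
    mink (- (w * emetric (Y p) (f1 p))) (w * emetric (Y p) (f0 p)) 0 0.
Proof.
have smYU := smooth_sec_restrict oU smY.
have [] := spin_frame_smooth oU sm1.
rewrite -/f0 -/f1 => smf0 smf1.
have [_ _ smg] := emetricP E.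
have dg (s t : section E) : smooth_sec U s -> smooth_sec U t ->
    diff_at (fun q => emetric (s q) (t q)) p.
  by move=> ss tt; apply: smooth_fun_diff (smg _ _ _ oU ss tt) Up.
have cre (f : M -> R) : diff_at f p -> cdiff_at (fun q => (f q)%:C) p.
  by move=> df; split; [exact: df|exact: diff_at_cst].
have cim (f : M -> R) : diff_at f p -> cdiff_at (fun q => 0 +i* f q) p.
  by move=> df; split; [exact: diff_at_cst|exact: df].
have dY0 := dg _ _ smYU smf0; have dY1 := dg _ _ smYU smf1.
have -> : (fun q => vcoord (Y q, 0) (s1 q) (s2 q)) = (fun q => quat
    (0 +i* (- emetric (Y q) (f0 q))) (emetric (Y q) (f1 q))%:C 0 0).
  by apply/funext => q; rewrite /vcoord !rmetric0l.
split.
  by apply: hdiff_quat; [apply: cim; apply: diff_atN|apply: cre|exact: cdiff_cst|exact: cdiff_cst].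
move=> X; cbv zeta; set w := emetric _ (f1 p).
rewrite dhc_quat !dcplx_cst /dcplx !dfun_cst.
have [e00 e11 e01 _ _] := spin_frameP (s1 p).
have d0 (s t : section E) : smooth_sec U s -> smooth_sec U t ->
    dfun (fun q => emetric (s q) (t q)) X =
    emetric (econn X s) (t p) + emetric (s p) (econn X t).
  by move=> ss tt; exact: (econn_metric X oU Up ss tt).
have n00 : emetric (econn X f0) (f0 p) = 0.
  have := d0 _ _ smf0 smf0.
  have -> : (fun q => emetric (f0 q) (f0 q)) = (fun=> -1).
    by apply/funext => q; have [] := spin_frameP (s1 q).
  by rewrite dfun_cst [X in _ + X]emetricC => /eqP; rewrite eq_sym -mulr2n mulrn_eq0 /= => /eqP.
have n11 : emetric (econn X f1) (f1 p) = 0.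
  have := d0 _ _ smf1 smf1.
  have -> : (fun q => emetric (f1 q) (f1 q)) = (fun=> 1).
    by apply/funext => q; have [] := spin_frameP (s1 q).
  by rewrite dfun_cst [X in _ + X]emetricC => /eqP; rewrite eq_sym -mulr2n mulrn_eq0 /= => /eqP.
have n10 : emetric (econn X f1) (f0 p) = - w.
  have := d0 _ _ smf0 smf1.
  have -> : (fun q => emetric (f0 q) (f1 q)) = (fun=> 0).
    by apply/funext => q; have [] := spin_frameP (s1 q).
  by rewrite dfun_cst [X in _ + X]emetricC => /eqP; rewrite eq_sym addrC addr_eq0 => /eqP.
have nf0 : econn X f0 = w *: f1 p.
  by rewrite {1}(Q1_decomp (spin_frameP (s1 p)) (econn X f0)) n00 oppr0 scale0r add0r.
have nf1 : econn X f1 = w *: f0 p.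
  rewrite (Q1_decomp (spin_frameP (s1 p)) (econn X f1)) n10 n11 opprK.
  by rewrite scale0r addr0.
rewrite dfunN // (d0 _ _ smYU smf0) (d0 _ _ smYU smf1) !parY !emetric0l.
rewrite nf0 nf1 !(emetricC (Y p)) !emetricZl !add0r.
by [].
Qed.

Let coord q := phi q (s1 q) (s2 q).
Let eta (X : tangent p) : HC R := hmul (nabla_coord phi s1 s2 X) (hbar (coord p)).

Lemma coord_diff : hdiff_at coord p.
Proof. by have [_ sm] := phiS; apply: smooth_hc_diff (sm _ _ _ oU sm1 sm2) Up. Qed.

(** Writing [dq = (eta - omega) q], with [omega] the connection form, the terms in
    [omega] cancel the differential of the coordinates of the parallel field [Y]. *)
Lemma spin_vec_dhc :
  hdiff_at (fun q => spin_vec phi (Y q, 0)) p /\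
  forall X : tangent p, dhc (fun q => spin_vec phi (Y q, 0)) X =
    hmul (hbar (coord p)) (hmul
      (hmul (hbar (eta X)) (vcoord (Y p, 0) (s1 p) (s2 p)) +
       hmul (vcoord (Y p, 0) (s1 p) (s2 p)) (hhat (eta X))) (hhat (coord p))).
Proof.
have [phiS' _] := phiS.
have -> : (fun q => spin_vec phi (Y q, 0)) = (fun q => hmul (hbar (coord q))
    (hmul (vcoord (Y q, 0) (s1 q) (s2 q)) (hhat (coord q)))).
  by apply/funext => q; exact: spin_vecE.
have dq := coord_diff; have dqb := hdiff_bar dq; have dqh := hdiff_hat dq.
have [dA dAE] := vcoord_parallel.
have [dAq dAqE] := dhc_hmul dA dqh.
have [dN dNE] := dhc_hmul dqb dAq.
split; first exact: dN.
move=> X; rewrite dNE dAqE dhc_bar // dhc_hat // dAE; cbv zeta.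
have etaq : hmul (eta X) (coord p) = nabla_coord phi s1 s2 X.
  by rewrite /eta -hmulA hbar_unit ?hmulq1 //; exact: phi_unit.
rewrite hmulDl [RHS]hmulDr -!hmulA -(hhatM (eta X)) (hmulA (hbar (coord p))).
rewrite -hbarM etaq /nabla_coord -/(coord p).
set w := emetric _ (f1 p); set t := rmetric _ _ _.
have wA : hmul (hbar (spin_conn_form w t)) (vcoord (Y p, 0) (s1 p) (s2 p)) +
   hmul (vcoord (Y p, 0) (s1 p) (s2 p)) (hhat (spin_conn_form w t)) =
   mink (- (w * emetric (Y p) (f1 p))) (w * emetric (Y p) (f0 p)) 0 0.
  rewrite /vcoord /= !rmetric0l.
  have := spin_conn_formE w t (- emetric (Y p) (f0 p)) (emetric (Y p) (f1 p)) 0 0.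
  have -> : hbar (spin_conn_form w t) = - spin_conn_form w t.
    by rewrite /spin_conn_form hbar_quat oppq oppr0.
  move=> /(congr1 -%R); rewrite opprB addrC hmulNl => ->.
  by rewrite /mink oppq; apply: eq_quat; complex_ring.
rewrite -wA; move: (spin_conn_form w t) (dhc coord X) (vcoord _ _ _) (coord p).
move=> om d A q; rewrite hbarD hhatD hbarM hhatM.
rewrite !(hmulDl, hmulDr) !hmulA -!addrA; congr (_ + (_ + _)).
exact: addrC.
Qed.

(** Combines [spin_vec_dhc] with [dirac_eta]: the scalar part of [eta] vanishes because
    [H(phi, phi)] is constant, and the relation required by [dirac_eta] is the Dirac
    equation multiplied on the right by the inverse of [qhat]. *)
Lemma parallel_dhc_frame : exists z22 z23 z32 z33,
  let e2 := (spin_frame (s2 p)).1 in let e3 := (spin_frame (s2 p)).2 in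
  [/\ dhc (fun q => spin_vec phi (Y q, 0)) e2 =
        spin_vec phi (0, z22 *: e2 + z23 *: e3),
      dhc (fun q => spin_vec phi (Y q, 0)) e3 =
        spin_vec phi (0, z32 *: e2 + z33 *: e3)
    & z22 + z33 = - 2 * emetric (Hvec p) (Y p)].
Proof.
cbv zeta; set e2 := (_).1; set e3 := (_).2.
have [phiS' _] := phiS; have q1 : hform (coord p) (coord p) = 1 by exact: phi_unit.
have [e22 e33 e23 _] := spin_frameP (s2 p).
have [dN dNE] := spin_vec_dhc.
have eta0 X : eta X 0 0 = 0.
  transitivity (hform (nabla_coord phi s1 s2 X) (coord p)).
    rewrite /eta; move: (nabla_coord _ _ _ _) (coord p) => n q.
    by rewrite hformE /hmul /hbar !quatE; ring.
  rewrite /nabla_coord hformDl -/(coord p) -{3}(hmul1q (coord p)) hformMr q1.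
  have [_ /(_ X)] := dcplx_form coord_diff coord_diff.
  have -> : (fun q => hform (coord q) (coord q)) = (fun=> 1).
    by apply/funext => q; exact: phi_unit.
  rewrite dcplx_cst (hformC (coord p)) => /esym/eqP.
  rewrite -mulr2n mulrn_eq0 /= => /eqP ->.
  by rewrite /spin_conn_form /hone hformE !quatE; ring.
have etaD : hmul (mink 0 0 1 0) (hhat (eta e2)) + hmul (mink 0 0 0 1) (hhat (eta e3)) =
    mink (- emetric (Hvec p) (f0 p)) (emetric (Hvec p) (f1 p)) 0 0.
  have := phiD oU sm1 sm2 Up; rewrite /dirac_coord /clifford -/e2 -/e3.
  rewrite /vcoord /= -/e2 -/e3 !emetric0l !rmetric0l e22 e33 e23 rmetricC e23 oppr0.
  rewrite -/(coord p) => D.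
  rewrite /eta !hhatM !hmulA -hmulDl D -hmulA -hhatM hunit_bar // hhat1 hmulq1.
  by [].
have [z22 [z23 [z32 [z33 [D2 D3 tr]]]]] := dirac_eta (eta0 e2) (eta0 e3) etaD
  (- emetric (Y p) (f0 p)) (emetric (Y p) (f1 p)).
have vY : vcoord (Y p, 0) (s1 p) (s2 p) =
    mink (- emetric (Y p) (f0 p)) (emetric (Y p) (f1 p)) 0 0.
  by rewrite /vcoord /= !rmetric0l.
have vT a b : vcoord (0, a *: e2 + b *: e3) (s1 p) (s2 p) = mink 0 0 a b.
  rewrite /vcoord /= -/e2 -/e3 !emetric0l oppr0 !rmetricDl !rmetricZl.
  by rewrite e22 e33 (rmetricC e3) e23 !mulr1 !mulr0 addr0 add0r.
exists z22, z23, z32, z33; split.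
- by rewrite dNE vY D2 (spin_vecE phiS' _ (s1 p) (s2 p)) vT.
- by rewrite dNE vY D3 (spin_vecE phiS' _ (s1 p) (s2 p)) vT.
- rewrite tr {3}(Q1_decomp (spin_frameP (s1 p)) (Hvec p)) emetricDl !emetricZl.
  by rewrite !(emetricC _ (Y p)); ring.
Qed.

End Local.

Section Parallel.
Variable Y : section E.
Hypotheses (smY : smooth_sec setT Y) (parY : forall p (X : tangent p), econn X Y = 0).

Lemma spin_vec_diff (p : M) : hdiff_at (fun q => spin_vec phi (Y q, 0)) p.
Proof.
have [U [s1 [s2 [oU Up sm1 sm2]]]] := local_spin_sections p.
by have [] := spin_vec_dhc oU Up sm1 sm2 smY parY.
Qed.

(** The connection of [E] corresponds to the normal connection of the immersion: a
    parallel section gives a normal field without normal derivative. *)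
Lemma parallel_dhc_tangent (p : M) (X : tangent p) : exists Z : tangent p,
  dhc (fun q => spin_vec phi (Y q, 0)) X = spin_vec phi (0, Z).
Proof.
have [U [s1 [s2 [oU Up sm1 sm2]]]] := local_spin_sections p.
have [z22 [z23 [z32 [z33 [d2 d3 _]]]]] := parallel_dhc_frame oU Up sm1 sm2 smY parY.
move: d2 d3; set e2 := (_).1; set e3 := (_).2 => d2 d3.
have phiS' := phiS.1.
rewrite (Q2_decomp (spin_frameP (s2 p)) X) -/e2 -/e3.
set x := rmetric g X e2; set y := rmetric g X e3.
exists (x *: (z22 *: e2 + z23 *: e3) + y *: (z32 *: e2 + z33 *: e3)).
by rewrite dhc_linear dhcZ d2 d3 !(spin_vec_tangentD phiS').
Qed.

(** The left-hand side is the trace of the second fundamental form in the direction of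
    [Y], up to sign, so this says that [Hvec] is the mean curvature vector. *)
Lemma parallel_dhc_trace (p : M) : exists e2 e3 : tangent p, Q2 g (e2, e3) /\
  hform (dhc (fun q => spin_vec phi (Y q, 0)) e2) (spin_vec phi (0, e2)) +
  hform (dhc (fun q => spin_vec phi (Y q, 0)) e3) (spin_vec phi (0, e3)) =
  (- 2 * emetric (Hvec p) (Y p))%:C.
Proof.
have [U [s1 [s2 [oU Up sm1 sm2]]]] := local_spin_sections p.
have [z22 [z23 [z32 [z33 [d2 d3 tr]]]]] := parallel_dhc_frame oU Up sm1 sm2 smY parY.
have [e22 e33 e23 _] := spin_frameP (s2 p).
exists (spin_frame (s2 p)).1, (spin_frame (s2 p)).2; split.
  by have := spin_frameP (s2 p); case: (spin_frame _).
rewrite d2 d3 !(spin_vec_form phiS.1 phi1) /= !emetric0l !rmetricDl !rmetricZl.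
rewrite e22 e33 (rmetricC (spin_frame (s2 p)).2) e23 -tr.
by complex_ring.
Qed.

End Parallel.
End ParallelField.

(** * Combinations of parallel sections with constant coefficients *)

Section Smooth.
Context {R : realType}.

(** The derivatives of order [n + 1] of [f] in [Ck] are those of the functions
    [x |-> 'd f x v] on the whole space, so that locality has to be proved by induction. *)
Lemma Ck_ext (V W : normedModType R) n (U : set V) (f h : V -> W) : open U ->
  (forall x, U x -> f x = h x) -> Ck n U f -> Ck n U h.
Proof.
move=> oU; elim: n f h => [|n IHn] f h fh /=.
  move=> cf x Ux; have fhx : {near x, f =1 h}.
    by apply: filterS (open_nbhs_nbhs (conj oU Ux)) => y /fh.
  rewrite /prop_for /continuous_at -(fh x Ux); apply: cvg_trans (cf x Ux).
  by apply: near_eq_cvg; apply: filterS fhx => y ->.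
move=> [df dfn]; have nE x : U x -> differentiable h x /\ 'd h x = 'd f x :> (V -> W).
  move=> Ux; apply: near_eq_is_diff (df x Ux).
  by apply: filterS (open_nbhs_nbhs (conj oU Ux)) => y /fh.
split=> [x Ux|v]; first by have [] := nE x Ux.
by apply: IHn (dfn v) => x Ux; have [_ ->] := nE x Ux.
Qed.

Lemma Ck_linear (V : normedModType R) n (U : set V) (a b : R) (f h : V -> R) :
  open U -> Ck n U f -> Ck n U h -> Ck n U (fun x => a * f x + b * h x).
Proof.
move=> oU; elim: n f h => [|n IHn] f h /=.
  move=> cf ch x Ux; apply: cvgD; apply: cvgM; [exact: cvg_cst|exact: cf|exact: cvg_cst|exact: ch].
move=> [df dfn] [dh dhn].
have dE x : U x -> is_diff x (fun x => a * f x + b * h x)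
    (a *: ('d f x : V -> R) + b *: ('d h x : V -> R)).
  move=> Ux; apply: is_diffD; apply: is_diffZ; apply: differentiableP.
  - exact: df.
  - exact: dh.
split=> [x Ux|v]; first by have := dE x Ux; case.
apply: Ck_ext (IHn _ _ (dfn v) (dhn v)) => // x Ux.
by have := dE x Ux => -[_ ->].
Qed.

Lemma Ck_cst (V : normedModType R) n (U : set V) (a : R) : Ck n U (fun=> a).
Proof.
elim: n a => [|n IHn] a /=; first by move=> x _; exact: cvg_cst.
split=> [x _|v]; first exact: differentiable_cst.
have -> : (fun x => 'd (fun=> a) x v) = (fun=> 0) :> (V -> R).
  by apply/funext => x; rewrite (_ : (fun=> a) = cst a) // diff_cst.
exact: IHn.
Qed.

Context {M : surface R}.

Lemma open_chart_image (p : M) (U : set M) : open U ->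
  open (chart p @` (dom p `&` U)).
Proof.
move=> oU; rewrite openE => _ [q [pq Uq] <-]; rewrite /interior.
have : \forall x \near chart p q, (chart p @` dom p) x.
  by apply: open_nbhs_nbhs; split; [exact: chart_open|exists q].
apply: filterS2 (near_chart_inv pq (open_nbhs_nbhs (conj oU Uq))) => x Ux [r pr rx].
by exists r => //; split => //; move: Ux; rewrite -rx chartK.
Qed.

Lemma smooth_fun_linear (U : set M) (a b : R) (f h : M -> R) : open U ->
  smooth_fun U f -> smooth_fun U h -> smooth_fun U (fun p => a * f p + b * h p).
Proof.
move=> oU sf sh p n; apply: Ck_linear (sf p n) (sh p n).
exact: open_chart_image.
Qed.

Lemma smooth_fun_cst (U : set M) (a : R) : smooth_fun U (fun=> a).
Proof. by move=> p n; exact: Ck_cst. Qed.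

Context {E : lorentz_bundle M}.

(** In a local frame the coefficients of the combination are combinations of those of
    [s] and [t]. *)
Lemma smooth_sec_linear (a b : R) (s t : section E) :
  smooth_sec setT s -> smooth_sec setT t ->
  smooth_sec setT (fun p => a *: s p + b *: t p).
Proof.
move=> sms smt; have [[_ glue] frames] := fibreP E.
apply: glue; first exact: openT.
move=> p _; have [U [u [v [oU Up [span sm]]]]] := frames p.
exists U; split => //.
have coef (r : section E) : exists x : M -> R * R, forall q, U q ->
    r q = (x q).1 *: u q + (x q).2 *: v q.
  have ex q : exists y : R * R, U q -> r q = y.1 *: u q + y.2 *: v q.
    have [Uq|nUq] := pselect (U q); last by exists (0, 0).
    by have [x [xE _]] := span q Uq (r q); exists x.
  by have [x xE] := choice ex; exists x.
have [x xE] := coef s; have [y yE] := coef t.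
have [smx1 smx2] : smooth_fun U (fun q => (x q).1) /\ smooth_fun U (fun q => (x q).2).
  by apply/(sm U s _ _ oU (@subset_refl _ U) xE); exact: smooth_sec_restrict.
have [smy1 smy2] : smooth_fun U (fun q => (y q).1) /\ smooth_fun U (fun q => (y q).2).
  by apply/(sm U t _ _ oU (@subset_refl _ U) yE); exact: smooth_sec_restrict.
apply/(sm U _ (fun q => a * (x q).1 + b * (y q).1)
  (fun q => a * (x q).2 + b * (y q).2) oU (@subset_refl _ U)).
  move=> q Uq; rewrite (xE q Uq) (yE q Uq) !scalerDr !scalerA addrACA.
  by rewrite -!scalerDl.
by split; exact: smooth_fun_linear.
Qed.

Lemma econn_linear (a b : R) (s t : section E) (p : M) (X : tangent p) :
  smooth_sec setT s -> smooth_sec setT t -> econn X s = 0 -> econn X t = 0 ->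
  econn X (fun q => a *: s q + b *: t q) = 0.
Proof.
move=> sms smt s0 t0; have [_ _ nD nM _] := econnP E.
have scale k (r : section E) : smooth_sec setT r -> econn X r = 0 ->
    smooth_sec setT (fun q => k *: r q) /\ econn X (fun q => k *: r q) = 0.
  move=> smr r0; split.
    have -> : (fun q => k *: r q) = (fun q => k *: r q + 0 *: r q).
      by apply: functional_extensionality_dep => q; rewrite scale0r addr0.
    exact: smooth_sec_linear.
  rewrite (nM setT p X (fun=> k) r openT I (smooth_fun_cst _ k) smr).
  by rewrite r0 dfun_cst scale0r scaler0 addr0.
have [smas as0] := scale a s sms s0; have [smbt bt0] := scale b t smt t0.
by rewrite (nD setT p X _ _ openT I smas smbt) as0 bt0 addr0.
Qed.

(** The orientations are preserved because [- g(u, x u + y v)] and [g(v, y u + x v)] are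
    both equal to [x]. *)
Lemma Q1_boost (p : M) (u v : E p) (x y : R) : Q1 (u, v) ->
  0 < x -> x ^+ 2 - y ^+ 2 = 1 -> Q1 (x *: u + y *: v, y *: u + x *: v).
Proof.
move=> [/= uu vv uv uF vF] x0 xy.
have [_ _ futE _] := futureP E; have [_ _ rigE _] := rightwardP E.
have g1 : emetric (x *: u + y *: v) (x *: u + y *: v) = -1.
  rewrite emetricDl !emetricZl !(emetricC _ (x *: u + y *: v)).
  rewrite !emetricDl !emetricZl uu vv (emetricC v) uv -[in RHS]xy; ring.
have g2 : emetric (y *: u + x *: v) (y *: u + x *: v) = 1.
  rewrite emetricDl !emetricZl !(emetricC _ (y *: u + x *: v)).
  rewrite !emetricDl !emetricZl uu vv (emetricC v) uv -[RHS]xy; ring.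
split => //=.
- rewrite emetricDl !emetricZl !(emetricC _ (y *: u + x *: v)).
  rewrite !emetricDl !emetricZl uu vv (emetricC v) uv; ring.
- apply/(futE p u) => //; first by rewrite g1 mulrNN mulr1.
  by rewrite emetricC emetricDl !emetricZl (emetricC v) uu uv; lra.
- apply/(rigE p v) => //; first by rewrite g2 mulr1.
  by rewrite emetricC emetricDl !emetricZl vv uv; lra.
Qed.

Lemma parallel_frame_boost (e0 e1 : section E) (x y : R) : parallel_frame e0 e1 ->
  0 < x -> x ^+ 2 - y ^+ 2 = 1 ->
  parallel_frame (fun p => x *: e0 p + y *: e1 p) (fun p => y *: e0 p + x *: e1 p).
Proof.
move=> [sm0 sm1 eQ n0 n1] x0 xy; split.
- exact: smooth_sec_linear.
- exact: smooth_sec_linear.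
- by move=> p; exact: Q1_boost.
- by move=> p X; apply: econn_linear.
- by move=> p X; apply: econn_linear.
Qed.

End Smooth.

(** * Pointwise form of the conditions on the spinor *)

Lemma det_col_rV2 (R : comRingType) (u v : 'rV[R]_2) :
  \det (col_mx u v : 'M[R]_2) = u 0 0 * v 0 1 - u 0 1 * v 0 0.
Proof.
have u0 j : col_mx u v (0 : 'I_2) j = u 0 j.
  by rewrite -(col_mxEu u v); congr (col_mx u v _ j); exact/val_inj.
have v1 j : col_mx u v (1 : 'I_2) j = v 0 j.
  by rewrite -(col_mxEd u v); congr (col_mx u v _ j); exact/val_inj.
move: (col_mx u v : 'M[R]_2) u0 v1 => A u0 v1.
rewrite (expand_det_row A 0) !big_ord_recl big_ord0 addr0 /cofactor !det_mx11 !mxE.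
have l1 : lift 1 0 = 0 :> 'I_2 by exact/val_inj.
have -> : lift ord0 ord0 = 1 :> 'I_2 by exact/val_inj.
by rewrite l1 (u0 0 : A 0 ord0 = _) (u0 1 : A 0 1 = _) (v1 0 : A 1 0 = _) (v1 1 : A 1 1 = _) addn0 add0n expr0 expr1; ring.
Qed.

Section Conditions.
Context {R : realType} {M : surface R} {g : riemannian M} {E : lorentz_bundle M}.
Context {S1 : spin_structure_E E} {S2 : spin_structure_M g}.

(** Positively oriented orthonormal frames [e2, e3] all have the same Clifford product
    [I]: it is the area element. *)
Lemma area_element (p : M) (s1 : S1 p) (s2 : S2 p) (e2 e3 : tangent p) :
  Q2 g (e2, e3) -> hmul (vcoord (0, e2) s1 s2) (hhat (vcoord (0, e3) s1 s2)) = hI.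
Proof.
move=> [/= e22 e33 e23 de]; have Qs := spin_frameP s2.
have f2E := Q2_decomp Qs e2; have f3E := Q2_decomp Qs e3.
have [f22 f33 f23 df] := Qs.
have vE (e : tangent p) : vcoord (0, e) s1 s2 =
    mink 0 0 (rmetric g e (spin_frame s2).1) (rmetric g e (spin_frame s2).2).
  by rewrite /vcoord /= !emetric0l oppr0.
rewrite !vE.
move: f2E f3E; move: (rmetric g e2 (_.1)) (rmetric g e2 (_.2)) => a b e2E.
move: (rmetric g e3 (_.1)) (rmetric g e3 (_.2)) => c d e3E.
have gE (x y x' y' : R) : rmetric g (x *: (spin_frame s2).1 + y *: (spin_frame s2).2)
    (x' *: (spin_frame s2).1 + y' *: (spin_frame s2).2) = x * x' + y * y'.
  rewrite rmetricDl !rmetricZl !(rmetricC _ (_ + _)) !rmetricDl !rmetricZl.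
  by rewrite f22 f33 (rmetricC (spin_frame s2).2) f23; ring.
have aa : a * a + b * b = 1 by rewrite -gE -e2E.
have cc : c * c + d * d = 1 by rewrite -gE -e3E.
have ac : a * c + b * d = 0 by rewrite -gE -e2E -e3E.
have ad : a * d - b * c = 1.
  have dd : 0 < a * d - b * c.
    move: de df; rewrite e2E e3E !det_col_rV2 !mxE.
    move=> de D0; rewrite -(pmulr_lgt0 _ D0); move: de.
    by congr (_ < _); ring.
  have : (a * d - b * c) ^+ 2 = 1.
    transitivity ((a * a + b * b) * (c * c + d * d) - (a * c + b * d) ^+ 2).
      by ring.
    by rewrite aa cc ac mul1r expr0n subr0.
  by move/eqP; rewrite sqrf_eq1 => /orP[/eqP //|/eqP d1]; move: dd; rewrite d1; lra.
rewrite /mink hhat_quat hmul_quat /hI; apply: eq_quat.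
- by transitivity (- (a * c + b * d)%:C); [complex_ring|rewrite ac oppr0].
- by transitivity ((a * d - b * c)%:C); [complex_ring|rewrite ad].
- by complex_ring.
- by complex_ring.
Qed.

(** Multiplication by [- i I] exchanges the two coordinates of a vector of [E], and so
    do the members of an orthonormal pair, up to a sign fixed by the orientations. *)
Lemma vcoord_swap (p : M) (s1 : S1 p) (s2 : S2 p) (u v : E p) : Q1 (u, v) ->
  vcoord (v, 0) s1 s2 = hmul (quat 0 (- 'i) 0 0) (vcoord (u, 0) s1 s2) /\
  vcoord (u, 0) s1 s2 = hmul (quat 0 (- 'i) 0 0) (vcoord (v, 0) s1 s2).
Proof.
move=> [/= uu vv uv uF vR].
have [e00 e11 e01 e0F e1R] := spin_frameP s1.
have [_ _ futE _] := futureP E; have [_ _ rigE _] := rightwardP E.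
have := vcoord_form (u, 0) (u, 0) s1 s2; have := vcoord_form (v, 0) (v, 0) s1 s2.
have := vcoord_form (u, 0) (v, 0) s1 s2.
have := (futE p _ u e0F _).1; rewrite uu mulrNN mulr1 => /(_ ltr01 uF).
have := (rigE p _ v e1R _).1; rewrite vv mulr1 => /(_ ltr01 vR).
rewrite !(emetricC (spin_frame s1).1) !(emetricC (spin_frame s1).2).
rewrite /vcoord !mink_form /= !rmetric0l uv !addr0 !mul1r !mulN1r.
move: (emetric u (_.1)) (emetric u (_.2)) (emetric v (_.1)) (emetric v (_.2)).
move=> a b c d.
move=> d0 a0 [] uv0 [] vv1 [] uu1.
have a2 : a ^+ 2 = 1 + b ^+ 2 by rewrite !expr2; lra.
have d2 : d ^+ 2 = 1 + c ^+ 2 by rewrite !expr2; lra.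
have acbd : a * c = b * d by lra.
have bc : b ^+ 2 = c ^+ 2.
  have : (a * c) ^+ 2 = (b * d) ^+ 2 by rewrite acbd.
  by rewrite !exprMn a2 d2; lra.
have da : d = - a.
  have : d ^+ 2 = (- a) ^+ 2 by rewrite sqrrN d2 a2 bc.
  by move/eqP; rewrite eqrXn2 // ?ltW // => /eqP.
have cb : c = - b.
  have : - a != 0 by rewrite lt0r_neq0.
  by move=> /mulfI; apply; rewrite mulNr acbd da; ring.
rewrite da cb opprK /mink !hmul_quat.
by split; apply: eq_quat; complex_ring.
Qed.

Variable phi : forall p, Sigma S1 S2 p.
Arguments phi p : clear implicits.
Hypothesis phiS : forall p, is_spinor_at (phi p).
Hypothesis phi1 : forall p, spinor_form (phi p) (phi p) = 1.

Lemma spin_vec_eq (p : M) (X : E p * tangent p) (s1 : S1 p) (s2 : S2 p) xi :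
  spin_vec phi X = xi <->
  hmul (vcoord X s1 s2) (hhat (phi p s1 s2)) = hmul (phi p s1 s2) xi.
Proof.
have q1 := phi_unit phiS phi1 s1 s2.
rewrite (spin_vecE phiS _ s1 s2); split=> [<-|->].
  by rewrite hmulA hunit_bar // hmul1q.
by rewrite hmulA hbar_unit // hmul1q.
Qed.

(** Since [e2 e3 = I], the condition on the right reads [[v] qhat = I q]; by
    [vcoord_swap] it means [[u] qhat = q i1]. *)
Lemma condition_R3_at (p : M) (u v : E p) : Q1 (u, v) ->
  spin_vec phi (u, 0) = mink 1 0 0 0 <->
  (forall e2 e3 : tangent p, Q2 g (e2, e3) ->
     clifford (v, 0) (phi p) = clifford (0, e2) (clifford (0, e3) (phi p))).
Proof.
move=> uvQ; have i1 (q : HC R) :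
    hmul (quat 0 (- 'i) 0 0) (hmul q (mink 1 0 0 0)) = hmul hI q.
  rewrite (quat_eta q) /mink /hI !hmul_quat.
  case: (q 0 0) (q 0 1) (q 0 2) (q 0 3) => ? ? [? ?] [? ?] [? ?].
  by apply: eq_quat; complex_ring.
have iI (q : HC R) : hmul (quat 0 (- 'i) 0 0) (hmul hI q) = hmul q (mink 1 0 0 0).
  rewrite (quat_eta q) /mink /hI !hmul_quat.
  case: (q 0 0) (q 0 1) (q 0 2) (q 0 3) => ? ? [? ?] [? ?] [? ?].
  by apply: eq_quat; complex_ring.
have cl (e2 e3 : tangent p) s1 s2 : Q2 g (e2, e3) ->
    clifford (0, e2) (clifford (0, e3) (phi p)) s1 s2 = hmul hI (phi p s1 s2).
  by move=> eQ; rewrite /clifford hhatM hhatK hmulA area_element.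
split=> [uE e2 e3 eQ|vE].
  apply: functional_extensionality_dep => s1.
  apply: functional_extensionality_dep => s2.
  rewrite cl // /clifford; have [-> _] := vcoord_swap s1 s2 uvQ.
  by rewrite -hmulA ((spin_vec_eq _ _ _ _).1 uE) i1.
pose s1 := spin_pt S1 p; pose s2 := spin_pt S2 p.
apply/(spin_vec_eq _ s1 s2); have [_ ->] := vcoord_swap s1 s2 uvQ.
have fQ : Q2 g ((spin_frame s2).1, (spin_frame s2).2).
  by have := spin_frameP s2; case: (spin_frame _).
have := cl _ _ s1 s2 fQ; rewrite -(vE _ _ fQ) /clifford -hmulA => ->.
exact: iI.
Qed.

Lemma condition_R12_at (p : M) (v : E p) (xi : HC R) :
  spin_vec phi (v, 0) = xi <->
  (forall s1 s2, clifford (v, 0) (phi p) s1 s2 = hmul (phi p s1 s2) xi).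
Proof.
split=> [vE s1 s2|vE]; first exact/(spin_vec_eq _ s1 s2).
by apply/(spin_vec_eq _ (spin_pt S1 p) (spin_pt S2 p)); exact: vE.
Qed.

End Conditions.

Lemma future_form_neg (R : realType) (xi zeta : HC R) (r : R) :
  R13 xi -> R13 zeta -> hform xi xi = -1 -> hform zeta zeta = -1 ->
  0 < complex.Im (xi 0 0) -> 0 < complex.Im (zeta 0 0) ->
  hform xi zeta = r%:C -> r < 0.
Proof.
move=> /R13_mink[x0 [x1 [x2 [x3 ->]]]] /R13_mink[y0 [y1 [y2 [y3 ->]]]].
rewrite !mink_form !quatE /= => -[xx _] [yy _] x0p y0p [rE]; rewrite -rE.
by apply: future_form => //; rewrite !expr2; lra.
Qed.

(** * Immersions in a hyperplane or in the hyperbolic space *)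

Lemma realC_inj (R : realType) (a b : R) : a%:C = b%:C -> a = b.
Proof. by case. Qed.

Section Immersion.
Context {R : realType} {M : surface R} {g : riemannian M} {E : lorentz_bundle M}.
Context {S1 : spin_structure_E E} {S2 : spin_structure_M g}.
Variables (e0 e1 Hvec : section E) (phi : forall p, Sigma S1 S2 p) (F : M -> HC R).
Arguments phi p : clear implicits.
Hypothesis Mc : path_connected (R := R) M.
Hypothesis eP : parallel_frame e0 e1.
Hypothesis phiF : is_spinor_field phi.
Hypothesis phiD : dirac_equation Hvec phi.
Hypothesis phi1 : forall p, spinor_form (phi p) (phi p) = 1.
Hypothesis immF : immersion_of phi F.

Let phiS := phiF.1.

Lemma immersion_dhc (p : M) (X : tangent p) : dhc F X = spin_vec phi (0, X).
Proof. by have [_ _] := immF; apply. Qed.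

Lemma immersion_diff (p : M) : hdiff_at F p.
Proof. by have [_ sF _] := immF; exact: smooth_hc_diff sF I. Qed.

Lemma normal_tangent (p : M) (u : E p) (X : tangent p) :
  hform (spin_vec phi (u, 0)) (spin_vec phi (0, X)) = 0.
Proof.
by rewrite (spin_vec_form phiS phi1) /= emetricC emetric0l rmetric0l addr0.
Qed.

Lemma normal_form (p : M) (u v : E p) :
  hform (spin_vec phi (u, 0)) (spin_vec phi (v, 0)) = (emetric u v)%:C.
Proof. by rewrite (spin_vec_form phiS phi1) /= rmetric0l addr0. Qed.

Lemma parallel_frame_Q1 (p : M) (a0 a1 : section E) : parallel_frame a0 a1 -> Q1 (a0 p, a1 p).
Proof. by case. Qed.

(** If [G] is normal and [dG] tangent, then the products of [G] with the normal fields
    defined by [e0] and [e1] have zero derivative, since these fields are also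
    differentiated into tangent ones. *)
Lemma normal_constant (G : M -> HC R) : (forall p, hdiff_at G p) ->
  (forall p, R13 (G p)) ->
  (forall p (X : tangent p), hform (G p) (spin_vec phi (0, X)) = 0) ->
  (forall p (X : tangent p), exists Z : tangent p, dhc G X = spin_vec phi (0, Z)) ->
  exists x y : R, forall p, G p = spin_vec phi (x *: e0 p + y *: e1 p, 0).
Proof.
move=> dG RG nG tG.
have normal p : exists u : E p, G p = spin_vec phi (u, 0).
  have [[u v] GE] := spin_vec_surj phiS phi1 p (RG p).
  exists u; suff v0 : v = 0 by rewrite GE v0.
  apply/eqP/negPn/negP => v0.
  have := nG p v; rewrite GE (spin_vec_form phiS phi1) /= emetricC emetric0l add0r.
  by move=> [] vv; have := rmetric_pos g v0; rewrite vv ltxx.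
have cst (Y : section E) : smooth_sec setT Y -> (forall p (X : tangent p), econn X Y = 0) ->
    forall p q, hform (G p) (spin_vec phi (Y p, 0)) = hform (G q) (spin_vec phi (Y q, 0)).
  move=> smY parY.
  apply: (zero_dcplx_cst (f := fun p => hform (G p) (spin_vec phi (Y p, 0))) Mc) => p.
  have [dGY dGYE] := dcplx_form (dG p) (spin_vec_diff phiF phi1 smY parY p).
  split; first exact: dGY.
  move=> X; rewrite dGYE; have [Z ->] := tG p X.
  have [Z' ->] := parallel_dhc_tangent phiF phi1 phiD smY parY X.
  by rewrite hformC normal_tangent nG addr0.
have [sm0 sm1 eQ n0 n1] := eP.
have [[p0 _]|noM] := pselect (exists p : M, True); last first.
  by exists 0, 0 => p; case: noM; exists p.
have [u0 G0] := normal p0.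
exists (- emetric u0 (e0 p0)), (emetric u0 (e1 p0)) => p.
have [u GE] := normal p; rewrite GE.
have := cst e0 sm0 n0 p p0; rewrite GE G0 !normal_form => /realC_inj <-.
have := cst e1 sm1 n1 p p0; rewrite GE G0 !normal_form => /realC_inj <-.
by rewrite {1}(Q1_decomp (eQ p) u).
Qed.

Lemma hform_translate (c m : HC R) (k : R[i]) :
  (forall p, hform (F p + c) m = k) ->
  forall p (X : tangent p), hform (spin_vec phi (0, X)) m = 0.
Proof.
move=> Fk p X.
have dFc : hdiff_at (fun q => F q + c) p.
  by apply: hdiffD; [exact: immersion_diff|exact: hdiff_cst].
have [_ /(_ X)] := dcplx_form dFc (@hdiff_cst R M m p).
have -> : (fun q => hform (F q + c) m) = (fun=> k) by apply/funext.
rewrite dcplx_cst dhc_cst (hformC (F p + c)) hform0l addr0.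
rewrite dhcD ?dhc_cst ?addr0 ?immersion_dhc //; first exact: immersion_diff.
exact: hdiff_cst.
Qed.

Lemma hyperplane (m : HC R) :
  (forall p (X : tangent p), hform (spin_vec phi (0, X)) m = 0) ->
  exists c, R13 c /\ forall p, R13 (F p + c) /\ hform (F p + c) m = 0.
Proof.
move=> Fm; have [RF _ _] := immF.
have [[p0 _]|noM] := pselect (exists p : M, True); last first.
  exists (mink 0 0 0 0); split; first exact: mink_R13.
  by move=> p; case: noM; exists p.
exists (- F p0); split; first exact: R13N.
move=> p; split; first by apply: R13D; [exact: RF|exact: R13N].
rewrite hformDl hformNl; apply/eqP; rewrite subr_eq0; apply/eqP.
apply: (zero_dcplx_cst (f := fun q => hform (F q) m) Mc) => q.
have [d dE] := dcplx_form (@immersion_diff q) (@hdiff_cst R M m q).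
split; first exact: d.
by move=> X; rewrite dE dhc_cst (hformC (F q)) hform0l addr0 immersion_dhc.
Qed.

Lemma immersion_R3 : condition_R3 Hvec phi e0 e1 -> belongs_to F R3.
Proof.
move=> [_ cond]; apply: hyperplane => p X.
rewrite -((condition_R3_at phiS phi1 (parallel_frame_Q1 p eP)).2 (cond p)).
by rewrite hformC normal_tangent.
Qed.

Lemma immersion_R12 : condition_R12 Hvec phi e0 e1 -> belongs_to F R12.
Proof.
move=> [_ cond]; apply: hyperplane => p X; case: cond => cond.
  rewrite -((condition_R12_at phiS phi1 (e1 p) hI).2 (cond p)).
  by rewrite hformC normal_tangent.
have cond' s1 s2 : clifford (e1 p, 0) (phi p) s1 s2 = hmul (phi p s1 s2) (- hI).
  by rewrite hmulNr; exact: cond.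
rewrite -[hI]opprK -((condition_R12_at phiS phi1 (e1 p) (- hI)).2 cond').
by rewrite hformNr hformC normal_tangent oppr0.
Qed.

Lemma immersion_H3 : condition_H3 Hvec phi e0 e1 -> belongs_to F H3.
Proof.
move=> [_ cond]; have [sm0 sm1 eQ n0 n1] := eP; have [RF _ _] := immF.
pose N p := spin_vec phi (e0 p, 0).
have [[p0 _]|noM] := pselect (exists p : M, True); last first.
  exists (mink 0 0 0 0); split; first exact: mink_R13.
  by move=> p; case: noM; exists p.
have NR p : R13 (N p) by exact: spin_vec_R13.
have cst p : F p + (N p0 - F p0) = N p.
  have : F p - N p = F p0 - N p0.
    apply: (zero_dhc_cst (f := fun q => F q - N q) Mc) => q.
    have dN := spin_vec_diff phiF phi1 sm0 n0 q.
    have -> : (fun q => F q - N q) = (fun q => F q + hmul (- hone) (N q)).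
      by apply/funext => r; rewrite hmulNl hmul1q.
    have [dcN dcNE] := dhc_hmul (@hdiff_cst R M (- hone) q) dN.
    split; first by apply: hdiffD; [exact: immersion_diff|exact: dcN].
    move=> X; rewrite (dhcD X (@immersion_diff q) dcN) dcNE dhc_cst.
    have -> : hmul 0 (N q) = 0 by rewrite -(scale0r hone) hmulZl !scale0r.
    by rewrite add0r hmulNl hmul1q /N /spin_vec cond immersion_dhc subrr.
  move=> /eqP; rewrite subr_eq => /eqP ->.
  by rewrite -(opprB (F p0)) addrAC subrr add0r.
exists (N p0 - F p0); split; first by apply: R13D; [exact: NR|apply: R13N; exact: RF].
move=> p; rewrite cst; have [/= uu _ _ uF _] := eQ p.
split; [exact: NR| |exact: spin_vec_future].
by rewrite /N normal_form uu; complex_ring.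
Qed.

Lemma normal_dhc (a0 : section E) (G : M -> HC R) :
  (forall p, G p = spin_vec phi (a0 p, 0)) ->
  forall p (X : tangent p), dhc (fun q => spin_vec phi (a0 q, 0)) X = dhc G X.
Proof. by move=> GE p X; congr dhc; apply/funext => q. Qed.

(** The sum in [parallel_dhc_trace] is [2 k], since [dF] is an isometry. *)
Lemma trace_tangent (a0 : section E) (k : R) :
  smooth_sec setT a0 -> (forall p (X : tangent p), econn X a0 = 0) ->
  (forall p (X : tangent p),
    dhc (fun q => spin_vec phi (a0 q, 0)) X = k%:C *: spin_vec phi (0, X)) ->
  forall p, emetric (Hvec p) (a0 p) = - k.
Proof.
move=> sm n dk p.
have [e2 [e3 [[/= e22 e33 _ _]]]] := parallel_dhc_trace phiF phi1 phiD sm n p.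
rewrite !dk !hformZl !(spin_vec_form phiS phi1) /= !emetric0l !add0r e22 e33.
by rewrite !mulr1 -raddfD => /realC_inj tr; lra.
Qed.

Lemma empty_frame (C : section E -> section E -> Prop) :
  ((exists p : M, True) -> exists a0 a1, parallel_frame a0 a1 /\ C a0 a1) ->
  ((forall p : M, False) -> C e0 e1) ->
  exists a0 a1, parallel_frame a0 a1 /\ C a0 a1.
Proof.
move=> Cp Ce; have [|noM] := pselect (exists p : M, True); first exact: Cp.
by exists e0, e1; split => //; apply: Ce => p; apply: noM; exists p.
Qed.

(** The constant vector [i1] is normal, hence defined by a parallel unit section [a0],
    and [a0] is orthogonal to the mean curvature vector because the field is constant. *)
Lemma R3_immersion : belongs_to F R3 ->
  exists a0 a1 : section E, parallel_frame a0 a1 /\ condition_R3 Hvec phi a0 a1.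
Proof.
move=> [c [_ Fc]]; apply: empty_frame => [[p0 _]|noM]; last first.
  by split; [exists (fun=> 0) => p; case: (noM p)|move=> p; case: (noM p)].
have F0 := hform_translate (fun p => (Fc p).2).
have [|||| x [y GE]] := @normal_constant (fun=> mink 1 0 0 0).
- by move=> p; exact: hdiff_cst.
- by move=> p; exact: mink_R13.
- by move=> p X; rewrite hformC F0.
- by move=> p X; exists 0; rewrite dhc_cst (spin_vec0 phiS).
have [/= e00 e11 e01 e0F _] := parallel_frame_Q1 p0 eP.
have xy : x ^+ 2 - y ^+ 2 = 1.
  have : hform (mink 1 0 0 0) (mink 1 0 0 0) = (-1)%:C :> R[i].
    by rewrite mink_form; congr (_%:C); ring.
  rewrite {1 2}(GE p0) normal_form => /realC_inj.
  rewrite emetricDl !emetricZl !(emetricC _ (_ + _)) !emetricDl !emetricZl.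
  by rewrite e00 e11 (emetricC (e1 p0)) e01 => xy; rewrite !expr2; lra.
have x0 : 0 < x.
  have := spin_vec_future phiS phi1 e00 e0F.
  have [z0 [z1 [z2 [z3 zE]]]] := R13_mink (spin_vec_R13 phiS (e0 p0, 0)).
  have : hform (mink 1 0 0 0) (spin_vec phi (e0 p0, 0)) = (- x)%:C.
    rewrite (GE p0) normal_form emetricDl !emetricZl e00 (emetricC (e1 p0)) e01.
    by congr (_%:C); ring.
  by rewrite zE mink_form quatE /= => /realC_inj; lra.
have aP := parallel_frame_boost eP x0 xy.
set a0 := fun p => x *: e0 p + y *: e1 p in aP.
set a1 := fun p => y *: e0 p + x *: e1 p in aP.
exists a0, a1; split => //; have [sm0 sm1 aQ n0 n1] := aP.
have Ha0 p : emetric (Hvec p) (a0 p) = - 0.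
  apply: (trace_tangent sm0 n0) => {}p X.
  by rewrite (normal_dhc (G := fun=> mink 1 0 0 0)) // dhc_cst scale0r.
split.
  exists (fun p => emetric (Hvec p) (a1 p)) => p.
  by rewrite {1}(Q1_decomp (aQ p) (Hvec p)) /= Ha0 !oppr0 scale0r add0r.
by move=> p; apply/(condition_R3_at phiS phi1 (aQ p)); rewrite -GE.
Qed.

(** As for [R3_immersion], with [I] in place of [i1].  The coefficient [y] of [e1] may be
    negative; then the section defining [-I] is used, whence the two signs. *)
Lemma R12_immersion : belongs_to F R12 ->
  exists a0 a1 : section E, parallel_frame a0 a1 /\ condition_R12 Hvec phi a0 a1.
Proof.
move=> [c [_ Fc]]; apply: empty_frame => [[p0 _]|noM]; last first.
  by split; [exists (fun=> 0) => p; case: (noM p)|left => p; case: (noM p)].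
have F0 := hform_translate (fun p => (Fc p).2).
have [|||| x [y GE]] := @normal_constant (fun=> hI).
- by move=> p; exact: hdiff_cst.
- by move=> p; exact: mink_R13 0 1 0 0.
- by move=> p X; rewrite hformC F0.
- by move=> p X; exists 0; rewrite dhc_cst (spin_vec0 phiS).
have [/= e00 e11 e01 e0F _] := parallel_frame_Q1 p0 eP.
have yx : y ^+ 2 - x ^+ 2 = 1.
  have : hform hI hI = 1%:C :> R[i].
    by rewrite /hI hformE !quatE; complex_ring.
  rewrite {1 2}(GE p0) normal_form => /realC_inj.
  rewrite emetricDl !emetricZl !(emetricC _ (_ + _)) !emetricDl !emetricZl.
  by rewrite e00 e11 (emetricC (e1 p0)) e01 => yx; rewrite !expr2; lra.
have main (s : R) : 0 < s * y -> s * s = 1 ->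
    exists a0 a1 : section E, [/\ parallel_frame a0 a1,
      exists H : M -> R, forall p, Hvec p = H p *: a0 p
    & forall p, spin_vec phi (a1 p, 0) = s%:C *: hI].
  move=> sy ss; have syx : (s * y) ^+ 2 - (s * x) ^+ 2 = 1.
    by rewrite !exprMn expr2 ss !mul1r.
  have aP := parallel_frame_boost eP sy syx.
  set a0 := fun p => (s * y) *: e0 p + (s * x) *: e1 p in aP.
  set a1 := fun p => (s * x) *: e0 p + (s * y) *: e1 p in aP.
  exists a0, a1; have [sm0 sm1 aQ n0 n1] := aP.
  have a1E p : spin_vec phi (a1 p, 0) = s%:C *: hI.
    rewrite (GE p) !(spin_vec_normalD phiS) scalerDr !scalerA.
    by congr (_ *: _ + _ *: _); complex_ring.
  split => //; exists (fun p => - emetric (Hvec p) (a0 p)) => p.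
  have Ha1 : emetric (Hvec p) (a1 p) = - 0.
    apply: (trace_tangent sm1 n1) => q X.
    by rewrite (normal_dhc (G := fun=> s%:C *: hI)) ?dhc_cst ?scale0r.
  by rewrite {1}(Q1_decomp (aQ p) (Hvec p)) /= Ha1 oppr0 scale0r addr0.
have [y0|y0|y0] := ltgtP 0 y.
- have [||a0 [a1 [aP Ha a1E]]] := main 1; rewrite ?mul1r //.
  exists a0, a1; split => //; split => //; left => p.
  by apply/(condition_R12_at phiS phi1); rewrite a1E scale1r.
- have [||a0 [a1 [aP Ha a1E]]] := main (-1); rewrite ?mulN1r ?oppr_gt0 ?opprK //.
  exists a0, a1; split => //; split => //; right => p s1 s2.
  rewrite /spinor_i -hmulNr; move: s1 s2.
  apply/(condition_R12_at phiS phi1); rewrite a1E -[RHS]scaleN1r.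
  by rewrite rmorphN1.
- by move: yx; rewrite -y0; have := sqr_ge0 x; rewrite expr0n /=; lra.
Qed.

(** The position vector [G] is normal because [H(G, G)] is constant, and [dG = dF], so
    that the trace identity holds with [k = 1].  [x > 0] because [G] is in the future. *)
Lemma H3_immersion : belongs_to F H3 ->
  exists a0 a1 : section E, parallel_frame a0 a1 /\ condition_H3 Hvec phi a0 a1.
Proof.
move=> [c [_ Fc]]; apply: empty_frame => [[p0 _]|noM]; last first.
  by split; [exists (fun=> 0) => p; case: (noM p)|move=> p; case: (noM p)].
pose G p := F p + c.
have dG p : hdiff_at G p.
  by apply: hdiffD; [exact: immersion_diff|exact: hdiff_cst].
have dGE p (X : tangent p) : dhc G X = spin_vec phi (0, X).
  rewrite /G dhcD ?dhc_cst ?addr0 ?immersion_dhc //; first exact: immersion_diff.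
  exact: hdiff_cst.
have [|||| x [y GE]] := @normal_constant G.
- exact: dG.
- by move=> p; have [] := Fc p.
- move=> p X; have [_ /(_ X)] := dcplx_form (dG p) (dG p).
  have -> : (fun q => hform (G q) (G q)) = (fun=> -1).
    by apply/funext => q; have [] := Fc q.
  rewrite dcplx_cst dGE (hformC (spin_vec _ _)) => /esym/eqP.
  by rewrite -mulr2n mulrn_eq0 /= => /eqP.
- by move=> p X; exists X; exact: dGE.
have [/= e00 e11 e01 e0F _] := parallel_frame_Q1 p0 eP.
have [GR GG G0] := Fc p0.
have xy : x ^+ 2 - y ^+ 2 = 1.
  have : hform (G p0) (G p0) = (-1)%:C by rewrite GG; complex_ring.
  rewrite (GE p0) normal_form => /realC_inj.
  rewrite emetricDl !emetricZl !(emetricC _ (_ + _)) !emetricDl !emetricZl.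
  by rewrite e00 e11 (emetricC (e1 p0)) e01 => xy; rewrite !expr2; lra.
have x0 : 0 < x.
  rewrite -oppr_lt0; apply: (future_form_neg GR (spin_vec_R13 phiS (e0 p0, 0)) GG _ G0).
  - by rewrite normal_form e00; complex_ring.
  - exact: spin_vec_future.
  - rewrite -/(G p0) (GE p0) normal_form emetricDl !emetricZl e00 (emetricC (e1 p0)) e01.
    by congr (_%:C); ring.
have aP := parallel_frame_boost eP x0 xy.
set a0 := fun p => x *: e0 p + y *: e1 p in aP.
set a1 := fun p => y *: e0 p + x *: e1 p in aP.
exists a0, a1; split => //; have [sm0 sm1 aQ n0 n1] := aP.
have dN p (X : tangent p) :
    dhc (fun q => spin_vec phi (a0 q, 0)) X = spin_vec phi (0, X).
  by rewrite (normal_dhc (G := G)).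
have Ha0 p : emetric (Hvec p) (a0 p) = -1.
  by apply: (trace_tangent sm0 n0) => {}p X; rewrite dN scale1r.
split.
  exists (fun p => emetric (Hvec p) (a1 p)) => p.
  by rewrite {1}(Q1_decomp (aQ p) (Hvec p)) /= Ha0 opprK scale1r.
by move=> p X; exact: dN.
Qed.

End Immersion.

Theorem proposition5p1 (R : realType) (M : surface R) (g : riemannian M)
    (E : lorentz_bundle M) (S1 : spin_structure_E E) (S2 : spin_structure_M g)
    (e0 e1 Hvec : section E) (phi : forall p, Sigma S1 S2 p) (F : M -> HC R) :
  simply_connected M ->
  parallel_frame e0 e1 ->
  smooth_sec setT Hvec ->
  is_spinor_field phi ->
  dirac_equation Hvec phi ->
  (forall p, spinor_form (phi p) (phi p) = 1) ->
  immersion_of phi F ->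
  ((condition_R3 Hvec phi e0 e1 -> belongs_to F R3) /\
   (condition_R12 Hvec phi e0 e1 -> belongs_to F R12) /\
   (condition_H3 Hvec phi e0 e1 -> belongs_to F H3)) /\
  ((belongs_to F R3 -> exists a0 a1 : section E,
      parallel_frame a0 a1 /\ condition_R3 Hvec phi a0 a1) /\
   (belongs_to F R12 -> exists a0 a1 : section E,
      parallel_frame a0 a1 /\ condition_R12 Hvec phi a0 a1) /\
   (belongs_to F H3 -> exists a0 a1 : section E,
      parallel_frame a0 a1 /\ condition_H3 Hvec phi a0 a1)).
Proof.
move=> [Mc _] eP _ phiF phiD phi1 immF; split.
  split; first exact: (immersion_R3 Mc eP phiF phi1 immF).
  by split; [exact: (immersion_R12 Mc phiF phi1 immF)|exact: (immersion_H3 Mc eP phiF phi1 immF)].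
split; first exact: (R3_immersion Mc eP phiF phiD phi1 immF).
by split; [exact: (R12_immersion Mc eP phiF phiD phi1 immF)|
  exact: (H3_immersion Mc eP phiF phiD phi1 immF)].
Qed.
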